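(* The varieties in the interval $[\mathbb{L}_2^1\vee\mathbb{Q}^1,\mathbb{E}^1]$ constitute the chain \[\mathbb{E}^1\{\sigma_1\}\subset\mathbb{E}^1\{\sigma_2\}\subset\cdots\subset\mathbb{E}^1\{\sigma_\infty\}\subset\mathbb{E}^1,\] that is, a monoid variety $\mathbb{V}$ satisfies $\mathbb{L}_2^1\vee\mathbb{Q}^1\subseteq\mathbb{V}\subseteq\mathbb{E}^1$ if and only if $\mathbb{V}$ is one of the varieties $\mathbb{E}^1\{\sigma_n\}$ ($n=1,2,3,\ldots$), $\mathbb{E}^1\{\sigma_\infty\}$, $\mathbb{E}^1$, and all the displayed inclusions are strict. Consequently, $\mathbb{L}_2^1\vee\mathbb{Q}^1=\mathbb{E}^1\{\sigma_1\}$.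
   Context: Monoids are algebras in the signature $\{\cdot,1\}$; a monoid variety is a class of monoids defined by a set of identities. For a semigroup $S$ without identity, $S^1=S\cup\{1\}$ is the monoid obtained by adjoining an identity. $\mathbb{E}^1,\mathbb{L}_2^1,\mathbb{Q}^1$ denote the monoid varieties generated by $E^1,L_2^1,Q^1$ respectively, where (with $0$ denoting a zero element) $E=\langle a,b,c\mid a^2=ab=0,\ ba=ca=a,\ b^2=bc=b,\ c^2=cb=c\rangle$, $L_2=\langle a,b\mid a^2=ab=a,\ b^2=ba=b\rangle$, $Q=\langle a,b,c\mid a^2=a,\ ab=b,\ ca=c,\ ac=ba=cb=0\rangle$. $\vee$ denotes the join of monoid varieties; $[\mathbb{U},\mathbb{V}]$ is the interval of all subvarieties of $\mathbb{V}$ containing $\mathbb{U}$; $\mathbb{E}^1\{\sigma\}$ is the subvariety of $\mathbb{E}^1$ defined by the identity $\sigma$. For $n\ge 1$, with distinct variables $x,y,h_1,h_2,\ldots$, $\sigma_n$ is the identity \[\sigma_n:\ \Big(\prod_{i=1}^n(\mathbf{e}_ih_i)\Big)x^2y^2\approx\Big(\prod_{i=1}^n(\mathbf{e}_ih_i)\Big)y^2x^2,\] where $\mathbf{e}_i=x^2$ if $i$ is odd and $\mathbf{e}_i=y^2$ if $i$ is even (products are taken in increasing order of $i$), and $\sigma_\infty$ is the identity $x^2y^2hx^2y^2\approx x^2y^2hy^2x^2$. *)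

(* Defs.v *)
(* Mathematical Components, with the classical axioms of MathComp-Analysis. *)
From HB Require Import structures.
From mathcomp Require Import all_boot.
From mathcomp Require Import boolp.

Set Implicit Arguments.
Unset Strict Implicit.
Unset Printing Implicit Defensive.

Local Open Scope quotient_scope.

(* Semigroup presentations <T | R>: the quotient of the term algebra over T by
   the least congruence that contains R and makes the product associative. *)

Inductive sgterm (T : Type) : Type :=
  | Gen of T
  | Mul of sgterm T & sgterm T.

HB.instance Definition _ (T : Type) := gen_eqMixin (sgterm T).
HB.instance Definition _ (T : Type) := gen_choiceMixin (sgterm T).

Declare Scope sgterm_scope.
Delimit Scope sgterm_scope with sgterm.
Bind Scope sgterm_scope with sgterm.
Notation "u * v" := (Mul u v) : sgterm_scope.

Inductive pres_cong (T : Type) (R : sgterm T -> sgterm T -> Prop) :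
    sgterm T -> sgterm T -> Prop :=
  | pres_base u v : R u v -> pres_cong R u v
  | pres_assoc u v w : pres_cong R (u * (v * w))%sgterm (u * v * w)%sgterm
  | pres_mul u u' v v' : pres_cong R u u' -> pres_cong R v v' ->
      pres_cong R (u * v)%sgterm (u' * v')%sgterm
  | pres_refl u : pres_cong R u u
  | pres_sym u v : pres_cong R u v -> pres_cong R v u
  | pres_trans u v w : pres_cong R u v -> pres_cong R v w -> pres_cong R u w.

Section Presented.

Variables (T : Type) (R : sgterm T -> sgterm T -> Prop).

Definition pres_rel : rel (sgterm T) := fun u v => `[< pres_cong R u v >].

Lemma pres_rel_refl : reflexive pres_rel.
Proof. by move=> u; apply/asboolP; apply: pres_refl. Qed.

Lemma pres_rel_sym : symmetric pres_rel.
Proof. by move=> u v; apply/asboolP/asboolP; apply: pres_sym. Qed.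

Lemma pres_rel_trans : transitive pres_rel.
Proof.
move=> v u w /asboolP uv /asboolP vw; apply/asboolP.
exact: pres_trans uv vw.
Qed.

Canonical pres_equiv := EquivRel pres_rel pres_rel_refl pres_rel_sym
  pres_rel_trans.

Definition presented : Type := {eq_quot pres_equiv}.

HB.instance Definition _ := Choice.on presented.

Definition pres_class (u : sgterm T) : presented := \pi_({eq_quot pres_equiv}) u.

Lemma pres_classP u v : pres_class u = pres_class v <-> pres_cong R u v.
Proof.
split; first by move/eqmodP/asboolP.
by move=> uv; apply/eqmodP/asboolP.
Qed.

Lemma pres_class_surj (p : presented) : exists u, p = pres_class u.
Proof. by exists (repr (p : {eq_quot pres_equiv})); rewrite /pres_class reprK. Qed.

Definition presented_mul (p q : presented) : presented :=
  pres_class (repr (p : {eq_quot pres_equiv}) *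
              repr (q : {eq_quot pres_equiv}))%sgterm.

Lemma presented_mulE u v :
  presented_mul (pres_class u) (pres_class v) = pres_class (u * v)%sgterm.
Proof.
by apply/pres_classP; apply: pres_mul; apply/pres_classP;
  rewrite /pres_class reprK.
Qed.

Lemma presented_mulA : associative presented_mul.
Proof.
move=> p q r; have [u ->] := pres_class_surj p.
have [v ->] := pres_class_surj q; have [w ->] := pres_class_surj r.
by rewrite !presented_mulE; apply/pres_classP; apply: pres_assoc.
Qed.

HB.instance Definition _ := isSemigroup.Build presented presented_mulA.

End Presented.

(* S^1 for a semigroup S without identity; the adjoined identity is None. *)
Definition adjoin1 (S : Type) : Type := option S.

Section Adjoin1.

Variable S : semigroupType.

HB.instance Definition _ := Choice.on (adjoin1 S).

Definition adjoin1_mul (p q : adjoin1 S) : adjoin1 S :=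
  match p, q with
  | None, _ => q
  | _, None => p
  | Some s, Some t => Some (s * t)%g
  end.

Lemma adjoin1_mulA : associative adjoin1_mul.
Proof. by move=> [s|] [t|] [r|] //=; rewrite mulgA. Qed.

Lemma adjoin1_mul1g : left_id None adjoin1_mul.
Proof. by []. Qed.

Lemma adjoin1_mulg1 : right_id None adjoin1_mul.
Proof. by case. Qed.

HB.instance Definition _ := isMonoid.Build (adjoin1 S)
  adjoin1_mulA adjoin1_mul1g adjoin1_mulg1.

End Adjoin1.

(* Adds to the relations R those saying that z is a zero element. *)
Definition with_zero (T : Type) (z : sgterm T) (R : sgterm T -> sgterm T -> Prop)
    (u v : sgterm T) : Prop :=
  R u v \/ (exists t, u = (z * t)%sgterm /\ v = z)
        \/ (exists t, u = (t * z)%sgterm /\ v = z).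

Inductive gen_abc0 := gen_a | gen_b | gen_c | gen_0.

Definition E_rel : sgterm gen_abc0 -> sgterm gen_abc0 -> Prop :=
  let a := Gen gen_a in let b := Gen gen_b in
  let c := Gen gen_c in let z := Gen gen_0 in
  with_zero z (fun u v => (u, v) \in
    [:: (a * a, z); (a * b, z); (b * a, a); (c * a, a);
        (b * b, b); (b * c, b); (c * c, c); (c * b, c)]%sgterm).

Definition Q_rel : sgterm gen_abc0 -> sgterm gen_abc0 -> Prop :=
  let a := Gen gen_a in let b := Gen gen_b in
  let c := Gen gen_c in let z := Gen gen_0 in
  with_zero z (fun u v => (u, v) \in
    [:: (a * a, a); (a * b, b); (c * a, c);
        (a * c, z); (b * a, z); (c * b, z)]%sgterm).

Inductive gen_ab := gen2_a | gen2_b.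

Definition L2_rel : sgterm gen_ab -> sgterm gen_ab -> Prop :=
  let a := Gen gen2_a in let b := Gen gen2_b in
  fun u v => (u, v) \in
    [:: (a * a, a); (a * b, a); (b * b, b); (b * a, b)]%sgterm.

Definition E1 : monoidType := adjoin1 (presented E_rel).
Definition Q1 : monoidType := adjoin1 (presented Q_rel).
Definition L21 : monoidType := adjoin1 (presented L2_rel).

(* Variables are natural numbers.  A term in the signature {., 1} is
   represented by the word it denotes in the free monoid. *)
Definition word : Type := seq nat.
Definition identity : Type := (word * word)%type.

Definition eval (M : monoidType) (f : nat -> M) (w : word) : M :=
  (\prod_(i <- w) f i)%g.

Definition satisfies (M : monoidType) (s : identity) : Prop :=
  forall f : nat -> M, eval f s.1 = eval f s.2.

(* Classes of monoids are plain predicates, compared extensionally: monoidType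
   lives in too large a universe for classical_sets.set. *)
Definition mclass : Type := monoidType -> Prop.

Definition mclass_eq (U V : mclass) : Prop := forall M, U M <-> V M.
Definition mclass_sub (U V : mclass) : Prop := forall M, U M -> V M.
Definition mclass_proper (U V : mclass) : Prop :=
  mclass_sub U V /\ ~ mclass_sub V U.

Declare Scope mclass_scope.
Delimit Scope mclass_scope with mclass.
Bind Scope mclass_scope with mclass.
Notation "U === V" := (mclass_eq U V) (at level 70) : mclass_scope.
Notation "U <= V" := (mclass_sub U V) : mclass_scope.
Notation "U < V" := (mclass_proper U V) : mclass_scope.
Local Open Scope mclass_scope.

Definition models (Sigma : identity -> Prop) : mclass :=
  fun M => forall s, Sigma s -> satisfies M s.

Definition is_variety (V : mclass) : Prop :=
  exists Sigma : identity -> Prop, V === models Sigma.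

(* The smallest variety containing M. *)
Definition variety_gen (M : monoidType) : mclass :=
  fun N => forall V, is_variety V -> V M -> V N.

(* The smallest variety containing U and V. *)
Definition variety_join (U V : mclass) : mclass :=
  fun N => forall W, is_variety W -> U <= W -> V <= W -> W N.

(* V{s} *)
Definition subvariety (V : mclass) (s : identity) : mclass :=
  fun M => V M /\ satisfies M s.

Definition varE1 := variety_gen E1.
Definition varQ1 := variety_gen Q1.
Definition varL21 := variety_gen L21.

Definition var_x : nat := 0.
Definition var_y : nat := 1.
(* h_1, h_2, ... are 2, 3, ... *)
Definition var_h (i : nat) : nat := i.+1.

Definition x2 : word := [:: var_x; var_x].
Definition y2 : word := [:: var_y; var_y].

Definition e_word (i : nat) : word := if odd i then x2 else y2.

Definition sigma_prefix (n : nat) : word :=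
  \big[cat/[::]]_(1 <= i < n.+1) (e_word i ++ [:: var_h i]).

Definition sigma (n : nat) : identity :=
  (sigma_prefix n ++ x2 ++ y2, sigma_prefix n ++ y2 ++ x2).

Definition sigma_inf : identity :=
  (x2 ++ y2 ++ [:: var_h 1] ++ x2 ++ y2, x2 ++ y2 ++ [:: var_h 1] ++ y2 ++ x2).

(* Main.v *)
Require Import Defs.
From HB Require Import structures.
From mathcomp Require Import all_boot.
From mathcomp Require Import boolp.

(* Two words agree in E^1 iff they have the same simple (once-occurring)
   letters, in the same order, and, in each block cut out by these letters, the
   same letters in the same order of first occurrences.  In Q^1 only the block
   contents count, and in L_2^1 only the global order of first occurrences.  So
   an identity of L_2^1 and Q^1 fails in E^1 only through discordances: a pair of letters x, y
   and a block in which the two sides order them differently.  Inside E^1, a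
   discordance is equivalent to sigma_n, where n counts the alternations
   between x and y in the blocks before it, or to sigma_infinity if an earlier
   block contains both x and y; bubble sorting the blocks shows that an identity
   is equivalent to its discordances together, hence to the strongest of them.

   Strictness: the syntactic monoid of the E^1-class of the left side of sigma_n
   satisfies sigma_(n+1) but not sigma_n, because in a word of that class only
   n runs of x and y precede the last block. *)

Set Implicit Arguments.
Unset Strict Implicit.
Unset Printing Implicit Defensive.

(** * Words, substitutions and presented semigroups *)

(** Alternations govern the matter because the h_i stand for arbitrary words: [sigma n] applies to
    two adjacent squares as soon as n alternating squares occur before them, whatever separates
    these. Conversely, deleting all letters except x, y and one separator per run, and merging equal
    adjacent squares, leaves the sides of [sigma n] up to renaming. Both directions work with
    squares, which E^1 permits: there xtx = x^2tx = xtx^2, and the squares generate a left regular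
    band (efe = ef). L_2^1 enters by excluding n = 0: if a pair were discordant in the first block
    that meets it, the global order of first occurrences would differ. The levels 1 < 2 < ... <
    infinity are well ordered, and inside E^1 a lower one implies every higher one; hence every set
    of levels has a strongest member and the interval is a chain. *)

Lemma eval_nil (M : monoidType) (f : nat -> M) : eval f [::] = 1%g.
Proof. by rewrite /eval big_nil. Qed.

Lemma eval_cons (M : monoidType) (f : nat -> M) i w :
  eval f (i :: w) = (f i * eval f w)%g.
Proof. by rewrite /eval big_cons. Qed.

Lemma eval_cat (M : monoidType) (f : nat -> M) u v :
  eval f (u ++ v) = (eval f u * eval f v)%g.
Proof. by rewrite /eval big_cat. Qed.

Lemma eval_morph (M N : monoidType) (phi : M -> N) (f : nat -> M) w :
  phi 1%g = 1%g -> {morph phi : x y / (x * y)%g} ->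
  phi (eval f w) = eval (phi \o f) w.
Proof.
move=> phi1 phiM; elim: w => [|i w IHw]; first by rewrite !eval_nil.
by rewrite !eval_cons phiM IHw.
Qed.

Definition subst (f : nat -> word) (w : word) : word := flatten [seq f i | i <- w].

Arguments subst : simpl never.

Lemma subst_cons f i w : subst f (i :: w) = f i ++ subst f w.
Proof. by []. Qed.

Lemma subst_cat f u v : subst f (u ++ v) = subst f u ++ subst f v.
Proof. by rewrite /subst map_cat flatten_cat. Qed.

Lemma eq_in_subst f g w : {in w, f =1 g} -> subst f w = subst g w.
Proof. by move=> fg; rewrite /subst; congr flatten; apply/eq_in_map. Qed.

Lemma eval_subst (M : monoidType) (f : nat -> word) (g : nat -> M) w :
  eval g (subst f w) = eval (fun i => eval g (f i)) w.
Proof.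
elim: w => [|i w IHw]; first by rewrite !eval_nil.
by rewrite subst_cons eval_cat eval_cons IHw.
Qed.

Lemma sat_inj (M N : monoidType) (phi : M -> N) s :
  phi 1%g = 1%g -> {morph phi : x y / (x * y)%g} -> injective phi ->
  satisfies N s -> satisfies M s.
Proof.
by move=> phi1 phiM phiI sN f; apply: phiI; rewrite !eval_morph.
Qed.

Lemma sat_adjoin1_inj (S T : semigroupType) (phi : S -> T) s :
  {morph phi : x y / (x * y)%g} -> injective phi ->
  satisfies (adjoin1 T) s -> satisfies (adjoin1 S) s.
Proof.
move=> phiM phiI; apply: (@sat_inj (adjoin1 S) (adjoin1 T) (omap phi)) => //.
- by case=> [x|] [y|] //; congr Some; apply: phiM.
- exact: inj_omap.
Qed.

(** * Finite models of the presented semigroups *)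

Section PresentedModel.

Variables (T : Type) (R : sgterm T -> sgterm T -> Prop) (S : semigroupType).
Variables (gen : T -> S) (psi : S -> presented R).

Fixpoint interp (u : sgterm T) : S :=
  match u with
  | Gen t => gen t
  | Mul u v => (interp u * interp v)%g
  end.

Hypothesis interpR : forall u v, R u v -> interp u = interp v.
Hypothesis psiM : {morph psi : s t / (s * t)%g}.
Hypothesis psi_gen : forall t, psi (gen t) = pres_class R (Gen t).
Hypothesis interp_surj : forall s, exists u, interp u = s.

Lemma interp_cong u v : pres_cong R u v -> interp u = interp v.
Proof.
elim=> {u v} //=.
- by move=> u v w; rewrite mulgA.
- by move=> u u' v v' _ -> _ ->.
- by move=> u v w _ -> _ ->.
Qed.

Lemma psi_interp u : psi (interp u) = pres_class R u.
Proof.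
elim: u => //= u IHu v IHv; rewrite psiM IHu IHv; exact: presented_mulE.
Qed.

Lemma psi_inj : injective psi.
Proof.
move=> s t; have [u <-] := interp_surj s; have [v <-] := interp_surj t.
by rewrite !psi_interp => /pres_classP/interp_cong.
Qed.

(** [psi] is an isomorphism: [interp] respects the congruence, which makes [psi] injective, and
    every class is the image of an interpreted term. Identities of the quotient can then be decided
    by cases on a finite multiplication table. *)
Lemma sat_presented s :
  satisfies (adjoin1 (presented R)) s <-> satisfies (adjoin1 S) s.
Proof.
split; first by apply: (sat_adjoin1_inj psiM psi_inj).
have surj p : exists t, psi t == p.
  by have [u ->] := pres_class_surj p; exists (interp u); rewrite psi_interp.
pose phi p := xchoose (surj p).
have phiK : cancel phi psi by move=> p; apply/eqP/(xchooseP (surj p)).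
apply: (@sat_adjoin1_inj _ _ phi) (can_inj phiK) => p q.
by apply: psi_inj; rewrite psiM !phiK.
Qed.

End PresentedModel.

(* [Ed] is ac in [E5], and [Qd] is bc in [Q5] below. *)
Inductive E5 := Ea | Eb | Ec | Ed | E0.
HB.instance Definition _ := gen_eqMixin E5.
HB.instance Definition _ := gen_choiceMixin E5.

Definition E5_mul (s t : E5) : E5 :=
  match s, t with
  | E0, _ | _, E0 => E0
  | Ea, (Ea | Eb | Ed) => E0
  | Ea, Ec => Ed
  | (Eb | Ec), Ea => Ea
  | (Eb | Ec), Ed => Ed
  | Eb, _ => Eb
  | Ec, _ => Ec
  | Ed, (Eb | Ec) => Ed
  | Ed, _ => E0
  end.

Lemma E5_mulA : associative E5_mul.
Proof. by do 3!case. Qed.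

HB.instance Definition _ := isSemigroup.Build E5 E5_mulA.

Inductive Q5 := Qa | Qb | Qc | Qd | Q0.
HB.instance Definition _ := gen_eqMixin Q5.
HB.instance Definition _ := gen_choiceMixin Q5.

Definition Q5_mul (s t : Q5) : Q5 :=
  match s, t with
  | Qa, (Qa | Qb | Qd) => t
  | (Qc | Qd), Qa => s
  | Qb, Qc => Qd
  | _, _ => Q0
  end.

Lemma Q5_mulA : associative Q5_mul.
Proof. by do 3!case. Qed.

HB.instance Definition _ := isSemigroup.Build Q5 Q5_mulA.

Inductive L2 := La | Lb.
HB.instance Definition _ := gen_eqMixin L2.
HB.instance Definition _ := gen_choiceMixin L2.

Definition L2_mul (s t : L2) : L2 := s.

Lemma L2_mulA : associative L2_mul.
Proof. by []. Qed.

HB.instance Definition _ := isSemigroup.Build L2 L2_mulA.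

Definition E5_gen g : E5 :=
  match g with gen_a => Ea | gen_b => Eb | gen_c => Ec | gen_0 => E0 end.

Definition Q5_gen g : Q5 :=
  match g with gen_a => Qa | gen_b => Qb | gen_c => Qc | gen_0 => Q0 end.

Definition L2_gen g : L2 := match g with gen2_a => La | gen2_b => Lb end.

Lemma with_zero_l T z R (t : sgterm T) :
  (pres_class (with_zero z R) z * pres_class (with_zero z R) t)%g =
  pres_class (with_zero z R) z.
Proof.
by rewrite [LHS]presented_mulE; apply/pres_classP/pres_base; right; left; exists t.
Qed.

Lemma with_zero_r T z R (t : sgterm T) :
  (pres_class (with_zero z R) t * pres_class (with_zero z R) z)%g =
  pres_class (with_zero z R) z.
Proof.
by rewrite [LHS]presented_mulE; apply/pres_classP/pres_base; right; right; exists t.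
Qed.

Lemma pres_mul_base T (R : sgterm T -> sgterm T -> Prop) u v w :
  R (u * v)%sgterm w ->
  (pres_class R u * pres_class R v)%g = pres_class R w.
Proof. by move=> Ruv; rewrite [LHS]presented_mulE; apply/pres_classP/pres_base. Qed.

Local Ltac table := by apply: pres_mul_base; left; rewrite !in_cons eqxx ?orbT.

Lemma sat_E1 s : satisfies E1 s <-> satisfies (adjoin1 E5) s.
Proof.
pose cl g := pres_class E_rel (Gen g).
pose psi e : presented E_rel := match e with
  | Ea => cl gen_a | Eb => cl gen_b | Ec => cl gen_c
  | Ed => (cl gen_a * cl gen_c)%g | E0 => cl gen_0 end.
have zl g : (cl gen_0 * cl g)%g = cl gen_0 by apply: with_zero_l.
have zr g : (cl g * cl gen_0)%g = cl gen_0 by apply: with_zero_r.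
have aa : (cl gen_a * cl gen_a)%g = cl gen_0 by table.
have ab : (cl gen_a * cl gen_b)%g = cl gen_0 by table.
have ba : (cl gen_b * cl gen_a)%g = cl gen_a by table.
have ca : (cl gen_c * cl gen_a)%g = cl gen_a by table.
have bb : (cl gen_b * cl gen_b)%g = cl gen_b by table.
have bc : (cl gen_b * cl gen_c)%g = cl gen_b by table.
have cc : (cl gen_c * cl gen_c)%g = cl gen_c by table.
have cb : (cl gen_c * cl gen_b)%g = cl gen_c by table.
apply: (@sat_presented _ _ _ E5_gen psi).
- move=> u v; case; last first.
    by case=> -[t [-> ->]] /=; case: (interp _ _).
  by rewrite !inE => /orP[|/orP[|/orP[|/orP[|/orP[|/orP[|/orP[|]]]]]]] /eqP[-> ->].
(* Products involving ac are reassociated to the right, so the relations are also needed with a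
   trailing factor [t]. *)
- have aa' t : (cl gen_a * (cl gen_a * t) = cl gen_0 * t)%g by rewrite mulgA aa.
  have ba' t : (cl gen_b * (cl gen_a * t) = cl gen_a * t)%g by rewrite mulgA ba.
  have ca' t : (cl gen_c * (cl gen_a * t) = cl gen_a * t)%g by rewrite mulgA ca.
  have za' t : (cl gen_0 * (cl gen_a * t) = cl gen_0 * t)%g by rewrite mulgA zl.
  by case; case; rewrite /psi /= -?mulgA ?(aa', ba', ca', za', zl, zr, aa, ab, ba, ca, bb, bc, cc, cb).
- by case.
- case.
  + by exists (Gen gen_a).
  + by exists (Gen gen_b).
  + by exists (Gen gen_c).
  + by exists (Gen gen_a * Gen gen_c)%sgterm.
  + by exists (Gen gen_0).
Qed.

Lemma sat_Q1 s : satisfies Q1 s <-> satisfies (adjoin1 Q5) s.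
Proof.
pose cl g := pres_class Q_rel (Gen g).
pose psi e : presented Q_rel := match e with
  | Qa => cl gen_a | Qb => cl gen_b | Qc => cl gen_c
  | Qd => (cl gen_b * cl gen_c)%g | Q0 => cl gen_0 end.
have zl g : (cl gen_0 * cl g)%g = cl gen_0 by apply: with_zero_l.
have zr g : (cl g * cl gen_0)%g = cl gen_0 by apply: with_zero_r.
have aa : (cl gen_a * cl gen_a)%g = cl gen_a by table.
have ab : (cl gen_a * cl gen_b)%g = cl gen_b by table.
have ca : (cl gen_c * cl gen_a)%g = cl gen_c by table.
have ac : (cl gen_a * cl gen_c)%g = cl gen_0 by table.
have ba : (cl gen_b * cl gen_a)%g = cl gen_0 by table.
have cb : (cl gen_c * cl gen_b)%g = cl gen_0 by table.
(* These two products are not among the relations: bb = b(ab) = (ba)b = 0 and cc = (ca)c = c(ac) =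
   0. *)
have bb : (cl gen_b * cl gen_b)%g = cl gen_0 by rewrite -[in X in (_ * X)%g]ab mulgA ba zl.
have cc : (cl gen_c * cl gen_c)%g = cl gen_0 by rewrite -[in X in (X * _)%g]ca -mulgA ac zr.
apply: (@sat_presented _ _ _ Q5_gen psi).
- move=> u v; case; last first.
    by case=> -[t [-> ->]] /=; case: (interp _ _).
  by rewrite !inE => /orP[|/orP[|/orP[|/orP[|/orP[|]]]]] /eqP[-> ->].
- have ab' t : (cl gen_a * (cl gen_b * t) = cl gen_b * t)%g by rewrite mulgA ab.
  have bb' t : (cl gen_b * (cl gen_b * t) = cl gen_0 * t)%g by rewrite mulgA bb.
  have cb' t : (cl gen_c * (cl gen_b * t) = cl gen_0 * t)%g by rewrite mulgA cb.
  have zb' t : (cl gen_0 * (cl gen_b * t) = cl gen_0 * t)%g by rewrite mulgA zl.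
  by case; case; rewrite /psi /= -?mulgA ?(ab', bb', cb', zb', zl, zr, aa, ab, ac, ba, ca, bb, cc, cb).
- by case.
- case.
  + by exists (Gen gen_a).
  + by exists (Gen gen_b).
  + by exists (Gen gen_c).
  + by exists (Gen gen_b * Gen gen_c)%sgterm.
  + by exists (Gen gen_0).
Qed.

Lemma sat_L21 s : satisfies L21 s <-> satisfies (adjoin1 L2) s.
Proof.
pose psi e := pres_class L2_rel (Gen (match e with La => gen2_a | Lb => gen2_b end)).
apply: (@sat_presented _ _ _ L2_gen psi).
- by move=> u v; rewrite /L2_rel !inE => /orP[|/orP[|/orP[|]]] /eqP[-> ->].
- by case; case; apply/esym/pres_mul_base; rewrite /L2_rel !in_cons eqxx ?orbT.
- by case.
- by case; [exists (Gen gen2_a) | exists (Gen gen2_b)].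
Qed.

(** The elements b and c of E form a left-zero semigroup, that is, a copy of L_2. *)
Lemma E1_L21 s : satisfies E1 s -> satisfies L21 s.
Proof.
rewrite sat_E1 sat_L21.
apply: (@sat_adjoin1_inj _ _ (fun e => match e with La => Eb | Lb => Ec end)).
- by do 2!case.
- by do 2!case.
Qed.

(* Q5^1 divides E5^1 x E5^1: the listed pairs (phi1 q, phi2 q), q generate a
   submonoid in which the first two components determine the third. *)
Lemma E1_Q1 s : satisfies E1 s -> satisfies Q1 s.
Proof.
rewrite sat_E1 sat_Q1 => sE f.
pose phi1 q : adjoin1 E5 := match q : adjoin1 Q5 with None => None
  | Some Qa => Some Eb | Some Qb => Some Ea
  | Some Qc => Some Ec | Some Qd => Some Ed | Some Q0 => Some E0 end.
pose phi2 q : adjoin1 E5 := match q : adjoin1 Q5 with None => None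
  | Some Qa => Some Eb | Some Qb => Some Eb
  | Some Qc => Some Ed | Some Qd => Some Ed | Some Q0 => Some Ea end.
pose rho (p1 p2 : adjoin1 E5) : adjoin1 Q5 := match p1, p2 with
  | None, None => None | Some Eb, Some Eb => Some Qa | Some Ea, Some Eb => Some Qb
  | Some Ec, Some Ed => Some Qc | Some Ed, Some Ed => Some Qd | _, _ => Some Q0 end.
pose dom (p1 p2 : adjoin1 E5) : Prop := match p1, p2 with
  | None, None | Some E0, Some (Ea | Eb | Ed | E0) | Some Ea, Some (Eb | Ed | E0)
  | Some Eb, Some (Eb | Ed | E0) | Some (Ec | Ed), Some (Ed | E0) => True
  | _, _ => False end.
(* Words are evaluated from the right end by adding letters on the left, so invariance of [dom]
   under left multiplication by the generating pairs suffices. *)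
have step p1 p2 q : dom p1 p2 -> dom (phi1 q * p1)%g (phi2 q * p2)%g /\
    rho (phi1 q * p1)%g (phi2 q * p2)%g = (q * rho p1 p2)%g.
  by move: p1 p2 q => [[]|] [[]|] [[]|].
have inv w : dom (eval (phi1 \o f) w) (eval (phi2 \o f) w) /\
    rho (eval (phi1 \o f) w) (eval (phi2 \o f) w) = eval f w.
  elim: w => [|i w [IHd IHr]]; first by rewrite !eval_nil.
  by rewrite !eval_cons -IHr; apply: step.
by rewrite -[LHS](inv _).2 -[RHS](inv _).2 !sE.
Qed.

(** * Deduction inside E^1 *)

(** Varieties are equational classes by definition, so it is enough to test [N] against the
    varieties given by a single identity of [M]. *)
Lemma variety_gen_sat (M N : monoidType) :
  variety_gen M N <-> forall s, satisfies M s -> satisfies N s.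
Proof.
split=> [genN s Ms | MN V [Sigma VE] /VE MV]; last first.
  by apply/VE => s Ss; apply/MN/MV.
have var_s : is_variety (models (eq s)) by exists (eq s).
by apply: (genN _ var_s) => // _ <-.
Qed.

Definition eqM (M : monoidType) (u v : word) := satisfies M (u, v).

Lemma eqM_refl M u : eqM M u u. Proof. by []. Qed.

Lemma eqM_sym M u v : eqM M u v -> eqM M v u.
Proof. by move=> uv f; rewrite uv. Qed.

Lemma eqM_trans M u v w : eqM M u v -> eqM M v w -> eqM M u w.
Proof. by move=> uv vw f; rewrite uv. Qed.

Lemma eqM_cat M u u' v v' : eqM M u u' -> eqM M v v' -> eqM M (u ++ v) (u' ++ v').
Proof. by move=> uu vv f; rewrite /= !eval_cat uu vv. Qed.

Lemma eqM_catl M p u v : eqM M u v -> eqM M (p ++ u) (p ++ v).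
Proof. exact: eqM_cat. Qed.

Lemma eqM_catr M p u v : eqM M u v -> eqM M (u ++ p) (v ++ p).
Proof. by move=> uv; apply: eqM_cat. Qed.

Lemma eqM_subst M f u v : eqM M u v -> eqM M (subst f u) (subst f v).
Proof. by move=> uv g; rewrite /= !eval_subst uv. Qed.

Lemma subst_filter (k : pred nat) u :
  subst (fun i => if k i then [:: i] else [::]) u = filter k u.
Proof. by elim: u => //= i u IHu; rewrite subst_cons IHu; case: (k i). Qed.

Lemma eqM_filter M (k : pred nat) u v :
  eqM M u v -> eqM M (filter k u) (filter k v).
Proof. by rewrite -!subst_filter; apply: eqM_subst. Qed.

Definition dbl (w : word) : word := subst (fun i => [:: i; i]) w.

Arguments dbl : simpl never.

Lemma dbl_cat u v : dbl (u ++ v) = dbl u ++ dbl v.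
Proof. exact: subst_cat. Qed.

Lemma dbl_cons i w : dbl (i :: w) = [:: i, i & dbl w].
Proof. by []. Qed.

Lemma mem_dbl i w : (i \in dbl w) = (i \in w).
Proof. by elim: w => //= j w IHw; rewrite dbl_cons !in_cons IHw orbA orbb. Qed.

Lemma filter_dbl k w : filter k (dbl w) = dbl (filter k w).
Proof.
elim: w => // j w IHw; rewrite dbl_cons /= IHw.
by case: (k j); rewrite ?dbl_cons.
Qed.

(** The idempotents of E^1, all elements except a and ac. They contain every square and form a left
    regular band. *)
Definition E5sq (e : adjoin1 E5) : bool :=
  match e with Some (Ea | Ed) => false | _ => true end.

Lemma E5sq_sqr (e : adjoin1 E5) : E5sq (e * e)%g.
Proof. by case: e => [[]|]. Qed.

Lemma E5sqM (e t : adjoin1 E5) : E5sq e -> E5sq t -> E5sq (e * t)%g.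
Proof. by case: e t => [[]|] [[]|]. Qed.

Lemma E5sq_absorb (e t : adjoin1 E5) :
  E5sq e -> E5sq t -> (e * t * e)%g = (e * t)%g.
Proof. by case: e t => [[]|] [[]|]. Qed.

(** With the next lemma, the laws xtx = x^2tx and xtx = xtx^2 of E^1; [q] is the value of the rest
    of the word. *)
Lemma E5_dbl_left (e t q : adjoin1 E5) :
  (e * (t * (e * q)))%g = (e * (e * (t * (e * q))))%g.
Proof. by case: e t q => [[]|] [[]|] [[]|]. Qed.

Lemma E5_dbl_right (e t q : adjoin1 E5) :
  (e * (t * (e * q)))%g = (e * (t * (e * (e * q))))%g.
Proof. by case: e t q => [[]|] [[]|] [[]|]. Qed.

Lemma E5sq_eval_dbl (f : nat -> adjoin1 E5) w : E5sq (eval f (dbl w)).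
Proof.
elim: w => [|i w IHw]; first by rewrite eval_nil.
rewrite dbl_cons !eval_cons mulgA; apply: E5sqM => //; exact: E5sq_sqr.
Qed.

Lemma E1_absorb w r : {subset r <= w} -> eqM E1 (dbl w ++ dbl r) (dbl w).
Proof.
move=> rw; apply/sat_E1 => f /=; rewrite eval_cat.
elim: r rw => [|x r IHr] rw; first by rewrite eval_nil mulg1.
rewrite -[RHS]IHr => [|i ir]; last by rewrite rw // in_cons ir orbT.
rewrite dbl_cons !eval_cons !mulgA; congr (_ * _)%g.
have /rw : x \in x :: r by rewrite mem_head.
case/splitPr => w1 w2; rewrite dbl_cat dbl_cons eval_cat !eval_cons.
set X := f x; set W := eval f (dbl w2).
rewrite -!mulgA; congr (_ * _)%g; rewrite !mulgA -[in LHS](mulgA (X * X * W)%g).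
by apply: E5sq_absorb; rewrite ?E5sq_sqr ?E5sq_eval_dbl.
Qed.

Section InsideE1.

Variable M : monoidType.
Hypothesis ME : varE1 M.

Lemma varE1_eqM u v : eqM E1 u v -> eqM M u v.
Proof. by move/variety_gen_sat: ME; apply. Qed.

Lemma eqM_absorb w r : {subset r <= w} -> eqM M (dbl w ++ dbl r) (dbl w).
Proof. by move=> rw; apply/varE1_eqM/E1_absorb. Qed.

End InsideE1.

(** * First occurrences, doubling of letters, and sorting of blocks *)

(** The letters in the order of their first occurrences; [undup] keeps last occurrences, hence the
    two reversals. *)
Definition ini (w : word) : word := rev (undup (rev w)).

Lemma ini_uniq w : uniq (ini w).
Proof. by rewrite rev_uniq undup_uniq. Qed.

Lemma mem_ini w : ini w =i w.
Proof. by move=> i; rewrite mem_rev mem_undup mem_rev. Qed.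

Lemma ini_rcons w x : ini (rcons w x) = if x \in w then ini w else rcons (ini w) x.
Proof.
by rewrite /ini rev_rcons /= mem_rev; case: ifP => // _; rewrite rev_cons.
Qed.

Lemma E1_ini w : eqM E1 (dbl w) (dbl (ini w)).
Proof.
elim/last_ind: w => // w x IHw; rewrite ini_rcons -cats1 dbl_cat.
case: ifP => xw; last by rewrite -cats1 dbl_cat; apply: eqM_catr.
apply: eqM_trans IHw; apply: E1_absorb => i; by rewrite inE => /eqP->.
Qed.

Definition dblS (S : pred nat) : word -> word :=
  subst (fun i => if S i then [:: i] else [:: i; i]).

(** A repeated letter has another occurrence to its left or to its right, so one of the two doubling
    laws squares it. In the induction [p] is the part already rewritten, and [inv] records that each
    unread letter outside [S] occurs in [p] or twice in the unread part. *)
Lemma E1_dblS S (u : word) : {in u, forall c, ~~ S c -> 1 < count_mem c u} ->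
  eqM E1 u (dblS S u).
Proof.
move=> Su; pose inv (p q : word) := forall c : nat, c \in q -> ~~ S c -> (c \in p) || (1 < count_mem c q).
suff main (q p : word) : inv p q -> eqM E1 (p ++ q) (p ++ dblS S q).
  by apply: (main u [::]) => c cu Sc; rewrite Su.
elim: q p => [|c q IHq] p pq; first by rewrite !cats0.
rewrite /dblS subst_cons; case: ifP => Sc.
  rewrite -cat_rcons [X in eqM _ _ X]catA cats1; apply: IHq => d dq Sd.
  have:= pq d _ Sd; rewrite in_cons dq orbT => /(_ isT) /=.
  rewrite mem_rcons in_cons => /orP[->|]; first by rewrite orbT.
  by case: eqP Sc Sd => [-> -> // | _ _ _ /= ->]; rewrite orbT.
have cpq : (c \in p) || (c \in q).
  have := pq c (mem_head _ _); rewrite Sc => /(_ isT) /orP[-> //|] /=.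
  by rewrite eqxx add1n ltnS -has_count has_pred1 orbC => ->.
apply: (@eqM_trans _ _ (p ++ [:: c, c & q])).
  apply/sat_E1 => f /=; case/orP: cpq => /splitPr[w1 w2].
    rewrite -!catA !cat_cons !(eval_cat, eval_cons).
    by congr (_ * _)%g; apply: E5_dbl_right.
  rewrite !(eval_cat, eval_cons).
  by congr (_ * _)%g; apply: E5_dbl_left.
rewrite -[[:: c, c & q]]/([:: c; c] ++ q) !catA; apply: IHq => d dq Sd.
have := pq d _ Sd; rewrite in_cons dq orbT => /(_ isT) /=.
rewrite mem_cat !in_cons (eq_sym c); case: eqP => [->|_] /=; rewrite ?orbT //=.
by rewrite add0n orbF.
Qed.

(** The normal form: blocks written as products of squares, each closed by a single separator. There
    is no block after the last separator. *)
Definition jn (bs : seq (word * nat)) : word :=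
  flatten [seq rcons (dbl b.1) b.2 | b <- bs].

Lemma jn_cons B z bs : jn ((B, z) :: bs) = dbl B ++ z :: jn bs.
Proof. by rewrite /jn /= cat_rcons. Qed.

Lemma jn_cat bs cs : jn (bs ++ cs) = jn bs ++ jn cs.
Proof. by rewrite /jn map_cat flatten_cat. Qed.

Lemma mem_jn i bs : (i \in jn bs) = has (fun b => (i \in b.1) || (i == b.2)) bs.
Proof.
elim: bs => //= -[B z] bs IHbs.
by rewrite jn_cons mem_cat in_cons mem_dbl IHbs orbA.
Qed.

Lemma filter_jn (k : pred nat) bs : {in bs, forall b, ~~ k b.2} ->
  filter k (jn bs) = dbl (filter k (flatten [seq b.1 | b <- bs])).
Proof.
elim: bs => //= -[B z] bs IHbs kbs; rewrite jn_cons !filter_cat dbl_cat filter_dbl /=.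
by rewrite (negPf (kbs (B, z) (mem_head _ _))) IHbs // => b bbs; rewrite kbs // in_cons bbs orbT.
Qed.

(** The arbitrary [r] keeps the exchange available behind the squares that sorting has already
    placed after [p]. *)
Definition Sw M (p : word) x y :=
  forall r, eqM M (p ++ r ++ dbl [:: x; y]) (p ++ r ++ dbl [:: y; x]).

Lemma Sw_catr M p q x y : Sw M p x y -> Sw M (p ++ q) x y.
Proof. by move=> sw r; rewrite -!catA !(catA q). Qed.

Lemma Sw_move M p w c : {in w, forall d, Sw M p d c} ->
  eqM M (p ++ dbl w ++ dbl [:: c]) (p ++ dbl [:: c] ++ dbl w).
Proof.
elim: w p => [|d w IHw] p sw; first by rewrite cats0.
apply: (@eqM_trans _ _ (p ++ dbl [:: d; c] ++ dbl w)).
  rewrite -[d :: w]/([:: d] ++ w) -[[:: d; c]]/([:: d] ++ [:: c]) !dbl_cat.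
  rewrite -!catA !(catA p); apply: IHw => e ew; apply: Sw_catr.
  by apply: sw; rewrite in_cons ew orbT.
rewrite -[d :: w]/([:: d] ++ w) dbl_cat !catA; apply: eqM_catr.
by rewrite !cats0 -!catA; apply: (sw d (mem_head _ _) [::]).
Qed.

(** Sorting by insertion: the first letter of [C] is moved to the front of [B], and it passes only
    letters that precede it in [B] and follow it in [C], for which an exchange is assumed. *)
Lemma Sw_sort M p B C : uniq B -> perm_eq B C ->
  (forall x y, subseq [:: x; y] B -> subseq [:: y; x] C -> Sw M p x y) ->
  eqM M (p ++ dbl B) (p ++ dbl C).
Proof.
elim: C B p => [|c C IHC] B p uB BC sw; first by rewrite (perm_nilP BC).
have : c \in B by rewrite (perm_mem BC) mem_head.
move=> cB; case/splitPr: cB uB BC sw => w B' uB BC sw.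
have BC' : perm_eq (w ++ B') C.
  by rewrite -(perm_cons c) -(permPr BC) perm_sym -[c :: B']cat1s perm_catCA.
have cwB : c \notin w ++ B'.
  by move: uB; rewrite -[c :: B']cat1s uniq_catCA => /andP[].
apply: (@eqM_trans _ _ (p ++ dbl [:: c] ++ dbl w ++ dbl B')).
  rewrite -[c :: B']cat1s !dbl_cat !(catA (dbl w)) !catA; apply: eqM_catr.
  rewrite -!catA; apply: Sw_move => d dw; apply: sw.
    by rewrite -[[:: d; c]]cat1s cat_subseq ?sub1seq // mem_head.
  by rewrite /= eqxx sub1seq -(perm_mem BC') mem_cat dw.
rewrite -[c :: C]cat1s (dbl_cat [:: c] C) -(dbl_cat w).
rewrite (catA p _ (dbl C)) (catA p _ (dbl (w ++ B'))).
apply: IHC => //.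
  by move: uB; rewrite -[c :: B']cat1s uniq_catCA => /andP[].
move=> x y xyB yxC; apply: Sw_catr; apply: sw.
  by apply: subseq_trans xyB _; apply: cat_subseq => //; apply: subseq_cons.
by apply: subseq_trans yxC _; apply: subseq_cons.
Qed.

(** * The identities sigma_n and runs of two letters *)

(** The prefixes behind which [sigma n] can act: the words between consecutive squares become the
    values of the h_i. *)
Fixpoint alternates (n c d : nat) (p : word) : Prop :=
  if n is n'.+1 then exists q r, p = q ++ [:: c, c & r] /\ alternates n' d c r
  else True.

Lemma alternates_catl n c d q p : alternates n c d p -> alternates n c d (q ++ p).
Proof.
by case: n => //= n [q' [r [-> nr]]]; exists (q ++ q'), r; rewrite catA.
Qed.

Lemma alternates_catr n c d p r : alternates n c d p -> alternates n c d (p ++ r).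
Proof.
elim: n c d p => //= n IHn c d p [q [r' [-> nr]]].
by exists q, (r' ++ r); rewrite -catA; split=> //; apply: IHn.
Qed.

(** The starting index [i] preserves parities and the names of the h_i when the first factor is
    removed. *)
Fixpoint sigma_run (i n : nat) : word :=
  if n is n'.+1 then e_word i ++ var_h i :: sigma_run i.+1 n' else [::].

Lemma sigma_prefixE n : sigma_prefix n = sigma_run 1 n.
Proof.
rewrite /sigma_prefix -[n.+1]/(1 + n); elim: n 1 => [|n IHn] i /=.
  by rewrite addn0 big_geq.
by rewrite big_ltn ?addnS ?ltnS ?leq_addr // -addSn IHn -catA.
Qed.

(** Read as a number, [~~ odd i] is the letter of e_i: 0, that is x, for odd [i], and 1, that is y,
    for even [i]. *)
Lemma alternates_sigma_run i n m : n <= m ->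
  alternates n (~~ odd i) (odd i) (sigma_run i m).
Proof.
elim: m n i => [|m IHm] [|n] i //; rewrite ltnS => nm.
exists [::], (var_h i :: sigma_run i.+1 m); split.
  by rewrite /= /e_word; case: (odd i).
rewrite -cat1s; apply: alternates_catl.
by have := IHm n i.+1 nm; rewrite /= negbK.
Qed.

Lemma mem_sigma_run i n j : j \in sigma_run i n -> (j < 2) || (i < j).
Proof.
elim: n i => //= n IHn i; rewrite mem_cat in_cons.
case/or3P => [|/eqP->|/IHn /orP[->//|/ltnW->]]; rewrite ?ltnSn ?orbT //.
by rewrite /e_word; case: (odd i); rewrite !inE orbb => /eqP->.
Qed.

(** What precedes the first square becomes [q], and the later gaps become the values of the h_i. As
    [i] is positive, these variables differ from 0 and 1, and the values can be prescribed
    independently. *)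
Lemma alternates_subst i n c d p : 0 < i ->
  alternates n (if odd i then c else d) (if odd i then d else c) p ->
  exists q (g : nat -> word),
    [/\ g 0 = [:: c], g 1 = [:: d] & p = q ++ subst g (sigma_run i n)].
Proof.
elim: n i p => [|n IHn] i p i0.
  move=> _; exists p, (fun j => if j == 0 then [:: c] else [:: d]).
  by rewrite cats0.
case=> q [r [-> nr]]; have [//||q' [g [g0 g1 rE]]] := IHn i.+1 r.
  by move: nr => /=; case: (odd i).
exists q, (fun j => if j == var_h i then q' else g j).
split; rewrite ?g0 ?g1 //; try by case: i i0 {nr rE}.
congr (_ ++ _); rewrite /= subst_cat subst_cons eqxx {1}rE.
rewrite (@eq_in_subst _ (fun j => if odd i then [:: c] else [:: d]) (e_word i)).
  rewrite (@eq_in_subst _ g (sigma_run i.+1 n)).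
    by rewrite /e_word; case: (odd i).
  by move=> j /mem_sigma_run; case: eqP => // ->; rewrite ltnn orbF; case: i i0 {nr rE}.
move=> j; rewrite /e_word; case: (odd i); rewrite !inE orbb => /eqP->; rewrite ?g0 ?g1;
  by case: i i0 {nr rE}.
Qed.

Lemma sigma_swap M n c d p : satisfies M (sigma n) -> alternates n c d p ->
  eqM M (p ++ dbl [:: c; d]) (p ++ dbl [:: d; c]).
Proof.
move=> Mn /(@alternates_subst 1 n c d p isT) [q [g [g0 g1 ->]]].
have := eqM_catl q (eqM_subst g Mn).
rewrite /= !subst_cat sigma_prefixE /x2 /y2 !subst_cons /var_x /var_y g0 g1.
by rewrite -!catA.
Qed.

(** A longer alternation contains a shorter one with the same first letter, so [sigma n] already
    exchanges the final squares of [sigma m]. *)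
Lemma sigma_leq M n m : n <= m -> satisfies M (sigma n) -> satisfies M (sigma m).
Proof.
move=> nm Mn; rewrite /sigma sigma_prefixE; apply: (sigma_swap Mn).
exact: (alternates_sigma_run 1 nm).
Qed.

Lemma alternates_nseq n c d :
  alternates n c d (dbl (flatten (nseq n [:: c; d]))) /\
  alternates n d c (dbl (flatten (nseq n [:: c; d]))).
Proof.
elim: n => //= n [cd dc]; split.
  exists [::], ([:: d; d] ++ dbl (flatten (nseq n [:: c; d]))).
  by split=> //; apply: alternates_catl.
by exists [:: c; c], (dbl (flatten (nseq n [:: c; d]))).
Qed.

(** In E^1, x^2y^2 equals its own n-th power, which contains n alternations. *)
Lemma sigma_sigma_inf M n : varE1 M -> 0 < n ->
  satisfies M (sigma n) -> satisfies M sigma_inf.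
Proof.
move=> ME n0 Mn; set z := var_h 1.
have wE : eqM M (dbl (flatten (nseq n [:: 0; 1]))) (dbl [:: 0; 1]).
  case: n n0 {Mn} => // n _.
  apply: (@eqM_absorb _ ME [:: 0; 1] (flatten (nseq n [:: 0; 1]))) => i.
  by move=> /flattenP [s /nseqP[-> _]].
have alt := alternates_catr [:: z] (alternates_nseq n 0 1).1.
apply: eqM_trans (eqM_trans _ (sigma_swap Mn alt)) _.
  by rewrite -catA; apply: eqM_catr (eqM_sym wE).
by rewrite -catA; apply: eqM_catr wE.
Qed.

(** The index is shifted because the identities start at [sigma 1]; [None] is the level infinity. *)
Definition level_identity (k : option nat) : identity :=
  if k is Some n then sigma n.+1 else sigma_inf.

Lemma level_min (K : option nat -> Prop) : (exists k, K k) ->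
  exists k, K k /\ forall k', K k' -> forall M, varE1 M ->
    satisfies M (level_identity k) -> satisfies M (level_identity k').
Proof.
move=> [k Kk]; case: (pselect (exists n, K (Some n))) => [[n Kn]|noK].
  have ex : exists n, `[< K (Some n) >] by exists n; apply/asboolP.
  case: (ex_minnP ex) => m /asboolP Km mP; exists (Some m); split=> // -[n'|] Kk' M ME.
    by apply: sigma_leq; rewrite ltnS mP //; apply/asboolP.
  exact: sigma_sigma_inf.
case: k Kk => [n Kn|KN]; first by case: noK; exists n.
by exists None; split=> // -[n Kn|//]; case: noK; exists n.
Qed.

Section Runs.

Variables x y : nat.

Definition letter (b : bool) : nat := if b then x else y.

(* [runs] lists the maximal runs of [x] or [y] across blocks; each run is paired
   with its last separator, and all other separators will be erased. *)
Definition push (b : bool) (z : nat) (T : seq (bool * nat)) :=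
  if T is (b', _) :: _ then if b' == b then T else (b, z) :: T else [:: (b, z)].

(** Blocks are read from the right, so a block with the letter of the run that follows is merged
    into it and loses its separator. A block with both letters is counted for [x]; the exact form of
    the erased word is claimed only when there is none. *)
Fixpoint runs (bs : seq (word * nat)) : seq (bool * nat) :=
  if bs is (B, z) :: bs' then
    if x \in B then push true z (runs bs')
    else if y \in B then push false z (runs bs') else runs bs'
  else [::].

Definition runs_word (T : seq (bool * nat)) : word :=
  flatten [seq [:: letter t.1; letter t.1; t.2] | t <- T].

Definition first_run (T : seq (bool * nat)) : bool := head true (unzip1 T).

Lemma runs_eq bs cs : unzip2 bs = unzip2 cs ->
  all2 (fun b c => ((x \in b.1) == (x \in c.1)) && ((y \in b.1) == (y \in c.1))) bs cs ->
  runs bs = runs cs.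
Proof.
elim: bs cs => [|[B z] bs IHbs] [|[C z'] cs] //= [-> zE] /andP[/andP[/eqP-> /eqP->] bc].
by rewrite (IHbs cs).
Qed.

Lemma runs_nil bs : runs bs = [::] ->
  {in bs, forall b, (x \notin b.1) && (y \notin b.1)}.
Proof.
have push_neq b z T : push b z T <> [::] by case: T => //= -[b' z'] T; case: eqP.
elim: bs => // -[B z] bs IHbs /=.
case: ifP => xB; first by move/push_neq.
case: ifP => yB; first by move/push_neq.
by move=> /IHbs{}IHbs b; rewrite in_cons => /orP[/eqP->|/IHbs //]; rewrite /= xB yB.
Qed.

Lemma push_cases b z T : b = first_run T /\ push b z T = T /\ T != [::] \/
  push b z T = (b, z) :: T /\ (T != [::] -> first_run T = ~~ b).
Proof.
case: T => [|[b' z'] T] /=; first by right.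
by rewrite /first_run /=; case: eqP => [->|]; [left|right; split=> // _; case: b b' n => -[]].
Qed.

Lemma runs_subseq bs : subseq (unzip2 (runs bs)) (unzip2 bs).
Proof.
have sub_push b z T s : subseq (unzip2 T) s -> subseq (unzip2 (push b z T)) (z :: s).
  move=> Ts; case: (push_cases b z T) => [[_ [-> _]] | [-> _]] /=; last by rewrite eqxx.
  exact: subseq_trans Ts (subseq_cons _ _).
elim: bs => // -[B z] bs IHbs; rewrite [runs _]/= [unzip2 (_ :: _)]/=.
by case: ifP => _; last case: ifP => _; rewrite ?sub_push //;
  apply: subseq_trans IHbs (subseq_cons _ _).
Qed.

Lemma runs_sub bs : {subset unzip2 (runs bs) <= unzip2 bs}.
Proof. exact/mem_subseq/runs_subseq. Qed.

Lemma runs_sorted bs : sorted (fun s t => s.1 != t.1) (runs bs).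
Proof.
have sorted_push b z T : sorted (fun s t => s.1 != t.1) T ->
    sorted (fun s t : bool * nat => s.1 != t.1) (push b z T).
  by case: T => //= -[b' z'] T; case: eqP => //= /eqP; rewrite eq_sym => ->.
by elim: bs => // -[B z] bs IHbs /=; case: ifP => _; last case: ifP => _; try apply: sorted_push.
Qed.

(** Each run supplies one square of its letter, and consecutive runs have different letters. *)
Lemma alternates_runs bs : let T := runs bs in
  alternates (size T) (letter (first_run T)) (letter (~~ first_run T)) (jn bs).
Proof.
have alt_push b z B bs' : letter b \in B -> let T := runs bs' in
    alternates (size T) (letter (first_run T)) (letter (~~ first_run T)) (jn bs') ->
    let T := push b z (runs bs') in
    alternates (size T) (letter (first_run T)) (letter (~~ first_run T)) (jn ((B, z) :: bs')).
  move=> bB /= alt; rewrite jn_cons -cat1s.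
  case: (push_cases b z (runs bs')) => [[_ [-> _]]|[-> bT]].
    by do 2!apply: alternates_catl.
  case/splitPr: bB => w1 w2; rewrite dbl_cat dbl_cons -catA.
  exists (dbl w1), (dbl w2 ++ [:: z] ++ jn bs'); split=> //.
  do 2!apply: alternates_catl; case: (runs bs') alt bT => // t T alt /(_ isT) bT.
  by move: alt; rewrite bT negbK.
elim: bs => // -[B z] bs IHbs /=.
case: ifP => xB; first exact: (alt_push true).
case: ifP => yB; first exact: (alt_push false).
by rewrite jn_cons -cat1s; do 2!apply: alternates_catl.
Qed.

Definition kept (T : seq (bool * nat)) : pred nat := mem [:: x, y & unzip2 T].

End Runs.

Lemma runs_word_cons x y t T :
  runs_word x y (t :: T) = [:: letter x y t.1; letter x y t.1; t.2] ++ runs_word x y T.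
Proof. by []. Qed.

Section RunsWord.

Variable M : monoidType.
Hypothesis ME : varE1 M.

Lemma eqM_dbl_const w c : c \in w -> {subset w <= [:: c]} ->
  eqM M (dbl w) (dbl [:: c]).
Proof.
case: w => // d w _ wc; have := wc d (mem_head _ _); rewrite inE => /eqP dc.
rewrite -cat1s dbl_cat dc; apply: eqM_absorb => // i iw.
by apply: wc; rewrite in_cons iw orbT.
Qed.

Variables x y : nat.

(** The new block contains just one of the two letters and shrinks to its square. Either this starts
    a new run and [z] is kept, or [z] is erased and the square is absorbed by the equal square that
    opens the next run. *)
Lemma filter_runs_push b z B bs : let T := push b z (runs x y bs) in
  letter x y b \in B -> letter x y (~~ b) \notin B ->
  z \notin unzip2 bs -> z \notin [:: x; y] -> {in B, forall i, i \notin z :: unzip2 bs} ->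
  z \notin jn bs ->
  eqM M (filter (kept x y (runs x y bs)) (jn bs)) (runs_word x y (runs x y bs)) ->
  eqM M (filter (kept x y T) (jn ((B, z) :: bs))) (runs_word x y T).
Proof.
set T' := runs x y bs; move=> T bB bNB zbs zxy Bbs zjn IH.
have T'z : z \notin unzip2 T' by apply: contra zbs => /runs_sub.
have subT i : i \in unzip2 T -> i \in z :: unzip2 bs.
  rewrite in_cons /T; case: (push_cases b z T') => [[_ [-> _]] /runs_sub-> |[-> _]].
    by rewrite orbT.
  by rewrite /= in_cons => /orP[->//|/runs_sub->]; rewrite orbT.
have keptB : {in B, kept x y T =1 (pred1 (letter x y b))}.
  move=> i iB; rewrite /kept /= !in_cons.
  have /negPf-> : i \notin unzip2 T by apply: contra (Bbs i iB) => /subT.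
  rewrite orbF; case: b bB bNB {T subT} => /= bB bNB.
    by case: (i =P y) => [E|_]; rewrite ?orbF //; move: iB bNB; rewrite E => ->.
  by case: (i =P x) => [E|_] //; move: iB bNB; rewrite E => ->.
have keptbs : filter (kept x y T) (jn bs) = filter (kept x y T') (jn bs).
  apply: eq_in_filter => i ijn; rewrite /kept /= !in_cons /T.
  case: (push_cases b z T') => [[_ [-> _]] //|[-> _]]; rewrite /= in_cons.
  by case: (i =P z) => // E; move: ijn zjn; rewrite E => ->.
rewrite jn_cons filter_cat filter_dbl [filter _ (z :: _)]/= keptbs.
rewrite (eq_in_filter keptB).
have BE : eqM M (dbl [seq i <- B | pred1 (letter x y b) i]) (dbl [:: letter x y b]).
  apply: eqM_dbl_const => [|i]; first by rewrite mem_filter /= eqxx.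
  by rewrite mem_filter inE => /andP[].
apply: eqM_trans (eqM_catr _ BE) _; rewrite /kept /= !in_cons.
move: zxy; rewrite !inE => /norP[/negPf-> /negPf->] /=.
rewrite /T; case: (push_cases b z T') => [[bE [-> T'n]]|[-> _]]; last first.
  rewrite /= mem_head runs_word_cons /=.
  by apply: (@eqM_catl M [:: letter x y b; letter x y b; z]).
rewrite (negPf T'z) /=; apply: eqM_trans (@eqM_catl M (dbl [:: letter x y b]) _ _ IH) _.
move: bE T'n; case: (T') => // -[b' t] T'' ; rewrite {1}/first_run /= => -> _; rewrite runs_word_cons.
apply: (@eqM_catr M (t :: runs_word x y T'') (dbl [:: letter x y b'; letter x y b']) (dbl [:: letter x y b'])).
exact: (@eqM_absorb M ME [:: letter x y b'] [:: letter x y b']).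
Qed.

Lemma filter_runs (bs : seq (word * nat)) :
  {in bs, forall b, ~~ ((x \in b.1) && (y \in b.1))} ->
  uniq (unzip2 bs) -> {in bs &, forall b c, b.2 \notin c.1} ->
  x \notin unzip2 bs -> y \notin unzip2 bs ->
  eqM M (filter (kept x y (runs x y bs)) (jn bs)) (runs_word x y (runs x y bs)).
Proof.
elim: bs => // -[B z] bs IHbs nb /= /andP[zbs ubs] sep.
rewrite !in_cons => /norP[xz xbs] /norP[yz ybs].
have IH : eqM M (filter (kept x y (runs x y bs)) (jn bs)) (runs_word x y (runs x y bs)).
  apply: IHbs => // [b bbs|b c bbs cbs].
    by apply: nb; rewrite in_cons bbs orbT.
  by apply: sep; rewrite in_cons ?bbs ?cbs orbT.
have zjn : z \notin jn bs.
  rewrite mem_jn; apply/hasPn => b bbs; apply/norP; split.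
    by apply: (sep (B, z) b); rewrite ?mem_head // in_cons bbs orbT.
  by apply: contra zbs => /eqP->; apply: map_f.
have BN : {in B, forall i, i \notin z :: unzip2 bs}.
  move=> i iB; rewrite in_cons; apply/norP; split.
    by apply: contraL iB => /eqP->; apply: (sep (B, z) (B, z)); rewrite mem_head.
  apply/mapP => -[b bbs ib]; move: iB; apply/negP; rewrite ib.
  by apply: (sep b (B, z)); rewrite ?mem_head // in_cons bbs orbT.
have zxy : z \notin [:: x; y] by rewrite !inE negb_or !(eq_sym z) xz.
have := nb (B, z) (mem_head _ _) => /=; case: ifP => xB /= yB.
  exact: filter_runs_push.
case: ifP => {}yB; first by apply: filter_runs_push; rewrite //= xB.
rewrite jn_cons filter_cat filter_dbl /=.
have sub := @runs_sub x y bs.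
have -> : filter (kept x y (runs x y bs)) B = [::].
  apply/eqP; rewrite -(negbK (_ == _)) -has_filter; apply/hasPn => i iB.
  rewrite /kept /= !in_cons; apply/negP => /or3P[/eqP ix|/eqP iy|/sub ibs].
  - by rewrite -ix iB in xB.
  - by rewrite -iy iB in yB.
  - by have := BN i iB; rewrite in_cons ibs orbT.
rewrite /= /kept /= !in_cons; move: zxy; rewrite !inE => /norP[/negPf-> /negPf->] /=.
by case: ifP => // /sub; rewrite (negPf zbs).
Qed.

End RunsWord.

(* Renames an alternating run word into the prefix of [sigma (size T)], whose
   variables h_1, h_2, ... are 2, 3, .... *)
Lemma subst_runs_word x y T i (g : nat -> word) :
  0 < i -> x != y ->
  sorted (fun s t => s.1 != t.1) T ->
  (T != [::] -> g (letter x y (first_run T)) = [:: ~~ odd i : nat]) ->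
  (T != [::] -> g (letter x y (~~ first_run T)) = [:: odd i : nat]) ->
  (forall j, j < size T -> g (nth 0 (unzip2 T) j) = [:: var_h (i + j)]) ->
  subst g (runs_word x y T) = sigma_run i (size T).
Proof.
elim: T i => //= -[b z] T IHT i i0 xy bT gb gNb gT.
rewrite runs_word_cons /= !subst_cons gb // (gT 0) // addn0.
have fr : T != [::] -> first_run T = ~~ b.
  by case: T bT {IHT gT gb gNb} => // -[b' z'] T /= /andP[bb' _] _; case: b b' bb' => -[].
rewrite (IHT i.+1) //.
- by rewrite /e_word; case: (odd i).
- exact: path_sorted bT.
- by move=> Tn; rewrite fr //= negbK gNb.
- by move=> Tn; rewrite fr //= negbK; apply: gb.
- by move=> j jT; rewrite (gT j.+1) // addnS.
Qed.

(** * Discordances *)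

Definition blocks_l (ds : seq (word * word * nat)) := [seq (d.1.1, d.2) | d <- ds].
Definition blocks_r (ds : seq (word * word * nat)) := [seq (d.1.2, d.2) | d <- ds].

(** A triple consists of a left block, a right block and their common separator. The conditions on
    left blocks pass to right blocks through the permutation, so the two sides may be exchanged by
    [flip]. *)
Record reduced (ds : seq (word * word * nat)) : Prop := Reduced {
  reduced_seps : uniq (unzip2 ds);
  reduced_sep : {in ds &, forall d e, d.2 \notin e.1.1};
  reduced_uniq : {in ds, forall d, uniq d.1.1};
  reduced_perm : {in ds, forall d, perm_eq d.1.1 d.1.2} }.

Lemma unzip2_blocks_l ds : unzip2 (blocks_l ds) = unzip2 ds.
Proof. by rewrite /unzip2 -map_comp. Qed.

Lemma unzip2_blocks_r ds : unzip2 (blocks_r ds) = unzip2 ds.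
Proof. by rewrite /unzip2 -map_comp. Qed.

Lemma jn_l_cat ds es : jn (blocks_l (ds ++ es)) = jn (blocks_l ds) ++ jn (blocks_l es).
Proof. by rewrite /blocks_l map_cat jn_cat. Qed.

Definition flip (d : word * word * nat) := ((d.1.2, d.1.1), d.2).

Lemma blocks_r_flip ds : blocks_r ds = blocks_l [seq flip d | d <- ds].
Proof. by rewrite /blocks_l -map_comp. Qed.

Lemma reduced_flip ds : reduced ds -> reduced [seq flip d | d <- ds].
Proof.
move=> [us sep ub perm]; split.
- by rewrite /unzip2 -map_comp.
- move=> _ _ /mapP[d dds ->] /mapP[e eds ->] /=.
  by rewrite -(perm_mem (perm e eds)); apply: sep.
- by move=> _ /mapP[d dds ->] /=; rewrite -(perm_uniq (perm d dds)) ub.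
- by move=> _ /mapP[d dds ->] /=; rewrite perm_sym perm.
Qed.

Lemma filter_mem2 (s t : word) : uniq t -> subseq s t -> forall (k : pred nat),
  {in t, k =1 mem s} -> filter k t = s.
Proof. by by move=> ut /(subseq_uniqP ut) sE k kt; rewrite [RHS]sE; apply: eq_in_filter. Qed.

(** * Erasing letters on one side of a discordance *)

Section Half.

Variables (M : monoidType) (ds1 ds2 : seq (word * word * nat)).
Variables (d : word * word * nat) (x y : nat) (s : word).
Hypothesis ME : varE1 M.
Let ds := ds1 ++ d :: ds2.
Hypothesis red : reduced ds.
Hypothesis sd : subseq s d.1.1.
Hypothesis sxy : s =i [:: x; y].

Let dds : d \in ds. Proof. by rewrite mem_cat mem_head orbT. Qed.

Lemma letters_not_seps i : i \in [:: x; y] -> i \notin unzip2 ds.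
Proof.
rewrite -sxy => /(mem_subseq sd) id; apply/mapP => -[e eds ie].
by move: id; apply/negP; rewrite ie; apply: (reduced_sep red).
Qed.

(** Once the separators are erased the remaining blocks merge, and the discordant block, containing
    both letters, absorbs the later ones. Here [s] is xy for the left side and yx for the right
    side, which is treated as the left side after a flip. *)
Lemma filter_tail (k : pred nat) :
  {in unzip2 (d :: ds2), forall t, ~~ k t} ->
  {in flatten [seq e.1.1 | e <- d :: ds2], k =1 mem [:: x; y]} ->
  eqM M (filter k (jn (blocks_l (d :: ds2)))) (dbl s).
Proof.
move=> kt kl; rewrite filter_jn; last first.
  by move=> _ /mapP[e eds ->]; apply: kt; exact: (map_f snd eds).
rewrite /blocks_l -map_comp /= filter_cat dbl_cat.
rewrite (@filter_mem2 s) //; last first.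
- by move=> i id; rewrite kl ?mem_cat ?id //= sxy.
- exact: (reduced_uniq red).
apply: eqM_absorb => // i; rewrite mem_filter => /andP[ki ids].
by rewrite sxy; move: ki; rewrite kl //= mem_cat ids orbT.
Qed.

Lemma filter_runs_word (T := runs x y (blocks_l ds1)) :
  {in ds1, forall e, ~~ ((x \in e.1.1) && (y \in e.1.1))} ->
  eqM M (filter (kept x y T) (jn (blocks_l ds))) (runs_word x y T ++ dbl s).
Proof.
move=> nb; rewrite jn_l_cat filter_cat.
have := reduced_seps red; rewrite /unzip2 map_cat cat_uniq => /and3P[us1 /hasPn us12 _].
have Tds1 : {subset unzip2 T <= unzip2 ds1}.
  by move=> i /runs_sub; rewrite unzip2_blocks_l.
have xds : x \notin unzip2 ds by apply: letters_not_seps; rewrite mem_head.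
have yds : y \notin unzip2 ds by apply: letters_not_seps; rewrite !inE eqxx orbT.
apply: eqM_cat; [apply: filter_runs => // | apply: filter_tail].
- by move=> _ /mapP[e eds ->]; apply: nb.
- by rewrite unzip2_blocks_l.
- move=> _ _ /mapP[e eds ->] /mapP[e' eds' ->].
  by apply: (reduced_sep red); rewrite mem_cat ?eds ?eds'.
- by rewrite unzip2_blocks_l; apply: contra xds; rewrite /unzip2 map_cat mem_cat => ->.
- by rewrite unzip2_blocks_l; apply: contra yds; rewrite /unzip2 map_cat mem_cat => ->.
- move=> t tds2; rewrite /kept /= !in_cons; apply/negP => /or3P[/eqP tx|/eqP ty|/Tds1].
  + by move: xds; rewrite -tx /unzip2 map_cat mem_cat tds2 orbT.
  + by move: yds; rewrite -ty /unzip2 map_cat mem_cat tds2 orbT.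
  + by apply/negP/us12.
- move=> i /flattenP[w /mapP[e eds ->] iw]; rewrite /kept /= !inE.
  have -> : i \in unzip2 T = false; last by rewrite orbF.
  apply/negbTE; apply: contraL iw => /Tds1/mapP[e' eds' ->].
  by apply: (reduced_sep red); rewrite mem_cat ?eds' ?eds ?orbT.
Qed.

(** Keeping only the last separator before the discordant block leaves the shape of [sigma_inf],
    except that x^2y^2 in front is replaced by an unknown product [w] of squares. *)
Lemma filter_last_sep es e : ds1 = rcons es e ->
  exists2 w : word, {subset w <= [:: x; y]} &
    eqM M (filter (mem [:: x; y; e.2]) (jn (blocks_l ds))) (dbl w ++ e.2 :: dbl s).
Proof.
move=> ds1E; pose k : pred nat := mem [:: x; y; e.2]; rewrite -/k.
have dsE : ds = es ++ [:: e] ++ d :: ds2 by rewrite /ds ds1E -cats1 -catA.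
have eds : e \in ds by rewrite dsE !mem_cat mem_head orbT.
have ees : e.2 \notin unzip2 es ++ unzip2 (d :: ds2).
  have := reduced_seps red.
  by rewrite dsE /unzip2 map_cat (map_cat _ [:: e]) uniq_catCA => /andP[].
have kletters : {in flatten [seq e'.1.1 | e' <- ds], k =1 mem [:: x; y]}.
  move=> i /flattenP[w /mapP[e' eds' wE] iw]; rewrite /k /= !in_cons.
  case: (i =P e.2) => [ie|_]; rewrite ?orbF //.
  by move: iw; rewrite wE ie (negPf (reduced_sep red eds eds')).
have kseps : {in unzip2 es ++ unzip2 (d :: ds2), forall t, ~~ k t}.
  move=> t tds; rewrite /k /= !in_cons; apply/negP.
  have tds' : t \in unzip2 ds.
    by move: tds; rewrite dsE /unzip2 !map_cat !mem_cat => /orP[->//|->]; rewrite !orbT.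
  case/or4P => [/eqP tx|/eqP ty|/eqP te|//].
  - have := @letters_not_seps x; rewrite mem_head -tx tds' => /(_ isT) //.
  - have := @letters_not_seps y; rewrite !inE eqxx orbT -ty tds' => /(_ isT) //.
  - by move: tds ees; rewrite te => ->.
have ke : k e.2 by rewrite /k /= !inE eqxx !orbT.
exists (filter k (flatten [seq e'.1.1 | e' <- es] ++ e.1.1)) => [i|].
  rewrite mem_filter => /andP[ki]; rewrite mem_cat => ies; move: ki; rewrite kletters //.
  by rewrite dsE map_cat flatten_cat /= !mem_cat; case/orP: ies => ->; rewrite ?orbT.
rewrite dsE 2!jn_l_cat (filter_cat _ (jn (blocks_l es))) (filter_cat _ (jn (blocks_l [:: e]))).
rewrite filter_jn; last first.
  move=> _ /mapP[e' ees' ->]; apply: kseps; rewrite mem_cat.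
  by have -> : (e'.1.1, e'.2).2 \in unzip2 es by exact: (map_f snd ees').
have -> : filter k (jn (blocks_l [:: e])) = dbl (filter k e.1.1) ++ [:: e.2].
  by rewrite jn_cons filter_cat filter_dbl /= ke.
rewrite /blocks_l -map_comp (filter_cat _ (flatten [seq e'.1.1 | e' <- es])) dbl_cat.
rewrite -!catA; do 2!apply: eqM_catl; apply: (@eqM_catl M [:: e.2]).
apply: filter_tail => [t tds|i ids].
  by apply: kseps; rewrite mem_cat tds orbT.
apply: kletters; rewrite dsE (map_cat _ es) flatten_cat mem_cat (map_cat _ [:: e]) flatten_cat mem_cat.
by rewrite ids !orbT.
Qed.

End Half.

Lemma map_fst_blocks_l ds : [seq b.1 | b <- blocks_l ds] = [seq d.1.1 | d <- ds].
Proof. by rewrite /blocks_l -map_comp. Qed.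

(** * The level of a discordance *)

Section Level.

Variables (ds1 ds2 : seq (word * word * nat)) (d : word * word * nat) (x y : nat).
Let ds := ds1 ++ d :: ds2.
Hypothesis red : reduced ds.
Hypothesis xyd : subseq [:: x; y] d.1.1.
Hypothesis yxd : subseq [:: y; x] d.1.2.

Let dds : d \in ds. Proof. by rewrite mem_cat mem_head orbT. Qed.

Let red' : reduced ([seq flip e | e <- ds1] ++ flip d :: [seq flip e | e <- ds2]).
Proof. by have := reduced_flip red; rewrite map_cat. Qed.

Let yxE : [:: y; x] =i [:: x; y].
Proof. by move=> i; rewrite !inE orbC. Qed.

Lemma discordant_neq : x != y.
Proof.
by have := subseq_uniq xyd (reduced_uniq red dds); rewrite /= inE andbT.
Qed.

(** Otherwise, keeping only x and y would leave words that start with x on one side and with y on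
    the other, and a valuation in a left-zero semigroup would separate them. *)
Lemma discordant_preceded : eqM L21 (jn (blocks_l ds)) (jn (blocks_r ds)) ->
  has (fun e => (x \in e.1.1) || (y \in e.1.1)) ds1.
Proof.
move=> UV; apply: contraT => /hasPn nds1.
have first2 (es1 es2 : seq (word * word * nat)) e s : reduced (es1 ++ e :: es2) ->
    subseq s e.1.1 -> s =i [:: x; y] ->
    {in es1, forall e', ~~ ((x \in e'.1.1) || (y \in e'.1.1))} ->
    exists w, filter (mem [:: x; y]) (jn (blocks_l (es1 ++ e :: es2))) = dbl (s ++ w).
  move=> rede se sxy nes1; exists (filter (mem [:: x; y]) (flatten [seq e'.1.1 | e' <- es2])).
  rewrite filter_jn; last first.
    move=> _ /mapP[e' e'ds ->]; apply/negP => /(letters_not_seps rede se sxy).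
    by rewrite (map_f snd e'ds : (e'.1.1, e'.2).2 \in _).
  rewrite map_fst_blocks_l map_cat flatten_cat filter_cat /= filter_cat.
  have -> : filter (mem [:: x; y]) (flatten [seq e'.1.1 | e' <- es1]) = [::].
    apply/eqP; rewrite -(negbK (_ == _)) -has_filter; apply/hasPn.
    move=> i /flattenP[w /mapP[e' ees' ->] ie']; apply: contra (nes1 _ ees').
    by rewrite !inE => /orP[] /eqP<-; rewrite ie' ?orbT.
  rewrite (@filter_mem2 s) //; last by move=> i _; rewrite /= sxy.
  by apply: (reduced_uniq rede); rewrite mem_cat mem_head orbT.
have [w wE] := first2 _ _ _ _ red xyd (fun _ => erefl) nds1.
have := first2 _ _ _ _ red' yxd yxE; case=> [_ /mapP[e eds ->]|w' w'E].
  by rewrite /= -!(perm_mem (reduced_perm red _)) ?mem_cat ?eds // nds1.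
have := eqM_filter (mem [:: x; y]) UV; rewrite wE.
rewrite blocks_r_flip map_cat w'E => /sat_L21 /(_ (fun i => (Some (if i == x then La else Lb) : adjoin1 L2))).
have left_zero t (X : adjoin1 L2) : ((Some t : adjoin1 L2) * X)%g = Some t by case: X.
by rewrite /= !dbl_cons !eval_cons !left_zero eqxx eq_sym (negPf discordant_neq).
Qed.

Let flip_l es : blocks_l [seq flip e | e <- es] = blocks_r es.
Proof. by rewrite blocks_r_flip. Qed.

(** Multiplying the erased identity by x^2y^2 on the left absorbs the unknown squares on both sides,
    which leaves [sigma_inf] up to renaming. *)
Lemma discordant_sigma_inf M : varE1 M ->
  has (fun e => (x \in e.1.1) || (y \in e.1.1)) ds1 ->
  eqM M (jn (blocks_l ds)) (jn (blocks_r ds)) -> satisfies M sigma_inf.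
Proof.
move=> ME hasxy UV; case/lastP ds1E : {2}ds1 (erefl ds1) => [|es e] // E.
  by move: hasxy; rewrite E.
have [w wxy wE] := filter_last_sep ME red xyd (fun _ => erefl) E.
have E' : [seq flip e | e <- ds1] = rcons [seq flip e | e <- es] (flip e).
  by rewrite E map_rcons.
have [w' wxy' wE'] := filter_last_sep ME red' yxd yxE E'.
have := eqM_trans (eqM_trans (eqM_sym wE) (eqM_filter _ UV)).
rewrite blocks_r_flip /ds map_cat => /(_ _ wE') /(eqM_catl (dbl [:: x; y])).
rewrite !(catA (dbl [:: x; y])) => H.
have absorb v u : {subset v <= [:: x; y]} ->
    eqM M ((dbl [:: x; y] ++ dbl v) ++ u) (dbl [:: x; y] ++ u).
  by move=> vxy; apply/eqM_catr/eqM_absorb.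
have {}H := eqM_trans (eqM_sym (absorb _ _ wxy)) (eqM_trans H (absorb _ _ wxy')).
have sep i : i \in [:: x; y] -> (e.2 == i) = false.
  move=> /(letters_not_seps red xyd (fun _ => erefl)) ids; apply: contraNF ids => /eqP<-.
  by apply: map_f; rewrite E mem_cat mem_rcons mem_head.
have := eqM_subst (fun i => if i == x then [:: var_x] else if i == y then [:: var_y] else [:: var_h 1]) H.
rewrite !(subst_cat, dbl_cons, subst_cons) !eqxx eq_sym (negPf discordant_neq).
by rewrite !sep // !inE eqxx ?orbT.
Qed.

(** Corresponding blocks have the same letters, so both sides have the same runs and erasing yields
    the same prefix on both. *)
Lemma discordant_sigma M (T := runs x y (blocks_l ds1)) : varE1 M ->
  ~~ has (fun e => (x \in e.1.1) && (y \in e.1.1)) ds1 ->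
  eqM M (jn (blocks_l ds)) (jn (blocks_r ds)) -> satisfies M (sigma (size T)).
Proof.
move=> ME /hasPn nb UV.
have ds1E e : e \in ds1 -> e.1.1 =i e.1.2.
  by move=> eds; apply/perm_mem/(reduced_perm red); rewrite mem_cat eds.
have TE : runs x y (blocks_l [seq flip e | e <- ds1]) = T.
  rewrite flip_l; apply: runs_eq; rewrite ?unzip2_blocks_l ?unzip2_blocks_r //.
  elim: ds1 ds1E => //= e es IH esE; rewrite !esE ?mem_head // !eqxx /=.
  by apply: IH => e' ees; apply: esE; rewrite in_cons ees orbT.
have lE := filter_runs_word ME red xyd (fun _ => erefl) nb.
have nb' : {in [seq flip e | e <- ds1], forall e, ~~ ((x \in e.1.1) && (y \in e.1.1))}.
  by move=> _ /mapP[e eds ->]; rewrite /= -!ds1E // nb.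
have := filter_runs_word ME red' yxd yxE nb'; rewrite TE => rE.
have := eqM_trans (eqM_trans (eqM_sym lE) (eqM_filter _ UV)).
rewrite blocks_r_flip /ds map_cat => /(_ _ rE) H.
have xy := discordant_neq.
(* The letter of the first run becomes x, even if it is [y]. The separator at index j becomes
   h_(j+1), which is the variable j + 2. *)
pose b := first_run T; pose g i := if i == letter x y b then [:: 0] else
  if i == letter x y (~~ b) then [:: 1] else [:: (index i (unzip2 T)).+2].
have neq : (letter x y (~~ b) == letter x y b) = false.
  by rewrite /letter; case: (b); rewrite /= ?(negPf xy) // eq_sym (negPf xy).
have uT : uniq (unzip2 T).
  apply: subseq_uniq (runs_subseq x y _) _; rewrite unzip2_blocks_l.
  by have := reduced_seps red; rewrite /unzip2 map_cat cat_uniq => /and3P[].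
have gT : subst g (runs_word x y T) = sigma_prefix (size T).
  rewrite sigma_prefixE; apply: subst_runs_word => //.
  - exact: runs_sorted.
  - by rewrite /g eqxx.
  - by rewrite /g neq eqxx.
  - move=> j jT; have jT' : j < size (unzip2 T) by rewrite size_map.
    have tds : nth 0 (unzip2 T) j \in unzip2 ds.
      have := runs_sub (mem_nth 0 jT'); rewrite unzip2_blocks_l /unzip2 map_cat mem_cat.
      by move=> ->.
    have sep i : i \in [:: x; y] -> (nth 0 (unzip2 T) j == i) = false.
      move=> /(letters_not_seps red xyd (fun _ => erefl)) ids.
      by apply: contraNF ids => /eqP<-.
    have lxy c : letter x y c \in [:: x; y] by case: c; rewrite !inE eqxx ?orbT.
    by rewrite /g !sep // index_uniq.
have {H} := eqM_subst g H.
rewrite !(subst_cat g (runs_word x y T)) gT !(dbl_cons, subst_cons) /g.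
(* If the first run belongs to [y], the renaming exchanges the letters and the sides of [sigma]
   appear in reverse order. *)
move: neq; rewrite /b; case: (first_run T) => /= neq; rewrite !eqxx neq //.
by move/eqM_sym.
Qed.

(* The number of alternations between [x] and [y] before the discordant block
   determines the identity equivalent to the discordance; a preceding block
   containing both letters counts as infinitely many alternations. *)
Lemma discordant_level : has (fun e => (x \in e.1.1) || (y \in e.1.1)) ds1 ->
  exists k, forall M, varE1 M ->
    (eqM M (jn (blocks_l ds)) (jn (blocks_r ds)) -> satisfies M (level_identity k)) /\
    (satisfies M (level_identity k) -> Sw M (jn (blocks_l ds1)) x y).
Proof.
have xy := discordant_neq.
move=> hasxy; case: (boolP (has (fun e => (x \in e.1.1) && (y \in e.1.1)) ds1)).
  move=> /hasP[e eds /andP[xe ye]]; exists None => M ME; split=> [|Minf r].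
    exact: discordant_sigma_inf.
  case/splitPr: eds => es1 es2; rewrite jn_l_cat jn_cons /=.
  set R := e.2 :: jn (blocks_l es2) ++ r.
  (* The block with both letters lets x^2y^2 be inserted after it, which provides the first factor
     of [sigma_inf]; it is removed again after the exchange. *)
  have eE : eqM M (dbl e.1.1) (dbl e.1.1 ++ dbl [:: x; y]).
    by apply/eqM_sym/eqM_absorb => // i; rewrite !inE => /orP[] /eqP->.
  have RE : eqM M (dbl [:: x; y] ++ R ++ dbl [:: x; y]) (dbl [:: x; y] ++ R ++ dbl [:: y; x]).
    (* Variables 0 and 1 go to x and y; the variable h lies beyond the list and takes the default
       value [R]. *)
    exact: (eqM_subst (fun i => nth R [:: [:: x]; [:: y]] i) Minf).
  have eRE s : eqM M (jn (blocks_l es1) ++ dbl e.1.1 ++ R ++ dbl s)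
      (jn (blocks_l es1) ++ dbl e.1.1 ++ dbl [:: x; y] ++ R ++ dbl s).
    by rewrite (catA (dbl e.1.1)); apply/eqM_catl/eqM_catr.
  have := eqM_trans (eRE [:: x; y]) (eqM_trans (eqM_catl _ (eqM_catl _ RE)) (eqM_sym (eRE [:: y; x]))).
  by rewrite /R -!catA !cat_cons -!catA.
move=> /hasPn nboth; pose T := runs x y (blocks_l ds1).
have T0 : 0 < size T.
  case TE : T => //; have := runs_nil TE => nT; case/hasP: hasxy => e eds.
  by have := nT (e.1.1, e.2); rewrite map_f // -negb_or => /(_ isT) /negPf->.
have TN : T != [::] by rewrite -size_eq0 -lt0n.
exists (Some (size T).-1) => M ME; rewrite /= prednK //; split=> [|MT r].
  by apply: discordant_sigma => //; apply/hasPn.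
have alt := alternates_catr r (alternates_runs x y (blocks_l ds1)).
have := sigma_swap MT alt; rewrite -!catA.
by rewrite -/T; case: (first_run T) => //= /eqM_sym.
Qed.

End Level.

(** * Block decompositions *)

(** Later blocks are sorted before earlier ones, so whenever a block is sorted its prefix still
    consists of left blocks, as the assumed exchanges require. *)
Lemma blocks_sort M ds : reduced ds ->
  (forall ds1 d ds2 x y, ds = ds1 ++ d :: ds2 ->
     subseq [:: x; y] d.1.1 -> subseq [:: y; x] d.1.2 ->
     Sw M (jn (blocks_l ds1)) x y) ->
  eqM M (jn (blocks_l ds)) (jn (blocks_r ds)).
Proof.
move=> red sw; suff main es2 es1 : ds = es1 ++ es2 ->
    eqM M (jn (blocks_l es1) ++ jn (blocks_l es2)) (jn (blocks_l es1) ++ jn (blocks_r es2)).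
  exact: (main ds [::]).
elim: es2 es1 => // d es2 IH es1 E.
have jl : jn (blocks_l (rcons es1 d)) = jn (blocks_l es1) ++ dbl d.1.1 ++ [:: d.2].
  by rewrite -cats1 jn_l_cat jn_cons.
have := IH (rcons es1 d); rewrite cat_rcons jl jn_cons [blocks_r _]/= jn_cons /= => /(_ E) H.
apply: eqM_trans (_ : eqM M _ (jn (blocks_l es1) ++ dbl d.1.1 ++ d.2 :: jn (blocks_r es2))) _.
  by move: H; rewrite -!catA.
rewrite !(catA (jn (blocks_l es1))); apply: eqM_catr.
have dds : d \in ds by rewrite E mem_cat mem_head orbT.
apply: Sw_sort; [exact: (reduced_uniq red)|exact: (reduced_perm red)|move=> x y].
exact: sw E.
Qed.

Lemma reduced_level ds : reduced ds ->
  eqM L21 (jn (blocks_l ds)) (jn (blocks_r ds)) ->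
  (forall M, varE1 M -> eqM M (jn (blocks_l ds)) (jn (blocks_r ds))) \/
  exists k, forall M, varE1 M ->
    (eqM M (jn (blocks_l ds)) (jn (blocks_r ds)) <-> satisfies M (level_identity k)).
Proof.
move=> red L2UV.
pose disc ds1 x y := exists d ds2,
  [/\ ds = ds1 ++ d :: ds2, subseq [:: x; y] d.1.1 & subseq [:: y; x] d.1.2].
pose lev ds1 x y k := forall M, varE1 M ->
  (eqM M (jn (blocks_l ds)) (jn (blocks_r ds)) -> satisfies M (level_identity k)) /\
  (satisfies M (level_identity k) -> Sw M (jn (blocks_l ds1)) x y).
have disc_lev ds1 x y : disc ds1 x y -> exists k, lev ds1 x y k.
  move=> [d [ds2 [E xy yx]]]; move: red L2UV; rewrite /lev E => red' L2UV'.
  exact: discordant_level red' xy yx (discordant_preceded red' xy yx L2UV').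
pose K k := exists ds1 x y, disc ds1 x y /\ lev ds1 x y k.
case: (pselect (exists k, K k)) => [/level_min [k [[ds1 [x [y [_ levk]]]] kmin]]|noK].
  right; exists k => M ME; split; first by apply: (levk M ME).1.
  move=> Mk; apply: blocks_sort => // es1 d es2 a b E ab ba.
  have ddisc : disc es1 a b by exists d, es2.
  have [k' levk'] := disc_lev _ _ _ ddisc.
  apply: (levk' M ME).2; apply: kmin Mk => //.
  by exists es1, a, b.
left=> M ME; apply: blocks_sort => // es1 d es2 a b E ab ba.
have ddisc : disc es1 a b by exists d, es2.
have [k' levk'] := disc_lev _ _ _ ddisc.
by case: noK; exists k', es1, a, b.
Qed.

Definition join_blocks (bs : seq (word * nat)) : word :=
  flatten [seq rcons b.1 b.2 | b <- bs].

Lemma join_blocks_cons B z bs : join_blocks ((B, z) :: bs) = B ++ z :: join_blocks bs.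
Proof. by rewrite /join_blocks /= cat_rcons. Qed.

Lemma join_blocks_cat bs cs : join_blocks (bs ++ cs) = join_blocks bs ++ join_blocks cs.
Proof. by rewrite /join_blocks map_cat flatten_cat. Qed.

Definition well_split (S : pred nat) (b : word * nat) : bool :=
  S b.2 && all (predC S) b.1.

(** The final letter in [S] closes the last block, so nothing is left over. *)
Lemma split_blocks (S : pred nat) u t : S t ->
  exists2 bs, rcons u t = join_blocks bs & all (well_split S) bs.
Proof.
move=> St; elim: u => [|c u [bs E wbs]].
  by exists [:: ([::], t)]; rewrite // /= /well_split /= St.
rewrite rcons_cons E; case: (boolP (S c)) => Sc.
  by exists (([::], c) :: bs); rewrite ?join_blocks_cons //= /well_split /= Sc.
case: bs E wbs => [|[B z] bs] E wbs.
  by case: (u) E.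
exists ((c :: B, z) :: bs); first by rewrite !join_blocks_cons.
by move: wbs; rewrite /= /well_split /= Sc.
Qed.

Lemma filter_join_blocks (S : pred nat) bs : all (well_split S) bs ->
  filter S (join_blocks bs) = unzip2 bs.
Proof.
elim: bs => //= -[B z] bs IHbs /andP[/andP[/= Sz BS] /IHbs E].
rewrite join_blocks_cons filter_cat /= Sz E.
have -> // : filter S B = [::].
by apply/eqP; rewrite -(negbK (_ == _)) -has_filter; apply/hasPn => i /(allP BS).
Qed.

Lemma dblS_join_blocks (S : pred nat) bs : all (well_split S) bs ->
  dblS S (join_blocks bs) = jn bs.
Proof.
elim: bs => //= -[B z] bs IHbs /andP[/andP[/= Sz BS] /IHbs E].
have dS w : dblS S (B ++ z :: w) = dblS S B ++ z :: dblS S w.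
  by rewrite /dblS subst_cat subst_cons Sz.
rewrite join_blocks_cons dS E jn_cons.
by congr (_ ++ _); apply: eq_in_subst => i /(allP BS) /= /negPf->.
Qed.

Lemma pair_blocks bs cs : unzip2 bs = unzip2 cs ->
  exists ds, bs = blocks_l ds /\ cs = blocks_r ds.
Proof.
elim: bs cs => [|[B z] bs IHbs] [|[C z'] cs] //=; first by exists [::].
case=> <- /IHbs [ds [-> ->]]; by exists (((B, C), z) :: ds).
Qed.

Definition ini_blocks (d : word * word * nat) := ((ini d.1.1, ini d.1.2), d.2).

Lemma E1_ini_blocks_l ds :
  eqM E1 (jn (blocks_l ds)) (jn (blocks_l [seq ini_blocks d | d <- ds])).
Proof.
elim: ds => // d ds IH; rewrite /= !jn_cons; apply: eqM_cat; first exact: E1_ini.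
exact: (@eqM_catl E1 [:: d.2]).
Qed.

Lemma E1_ini_blocks_r ds :
  eqM E1 (jn (blocks_r ds)) (jn (blocks_r [seq ini_blocks d | d <- ds])).
Proof.
elim: ds => // d ds IH; rewrite /= !jn_cons; apply: eqM_cat; first exact: E1_ini.
exact: (@eqM_catl E1 [:: d.2]).
Qed.

Lemma fresh (w : word) : exists t, t \notin w.
Proof.
exists (\max_(i <- w) i).+1; apply/negP => tw.
by have := @leq_bigmax_seq _ w xpredT id _ tw isT; rewrite ltnn.
Qed.

(** * What Q^1 detects in a word *)

Definition simple (w : word) : pred nat := fun c => count_mem c w == 1.

(** Sending [z] to b and all other letters to 1 gives 1, b or 0 according to whether [z] occurs
    never, once or more often, since b^2 = 0. *)
Lemma Q1_simple u v : eqM Q1 u v -> simple u =1 simple v.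
Proof.
move=> /sat_Q1 uv z.
pose f i : adjoin1 Q5 := if i == z then Some Qb else None.
have ev w : eval f w = match count_mem z w with
    0 => None | 1 => Some Qb | _ => Some Q0 end :> adjoin1 Q5.
  elim: w => [|i w IHw]; first by rewrite eval_nil.
  by rewrite eval_cons IHw /f /=; case: eqP => _ /=; case: (count_mem z w) => [|[|n]].
have := uv f; rewrite /= !ev /simple.
by case: (count_mem z u) => [|[|n]]; case: (count_mem z v) => [|[|m]].
Qed.

(** A probe for [x] between the simple letters [z] and [z']: as ab = b and ca = c, occurrences of
    [x] outside are invisible, while ba = 0 reveals one inside. If [z'] comes first, cb = 0
    annihilates the word. *)
Definition Q5_test (z z' x i : nat) : adjoin1 Q5 :=
  if i == z then Some Qb else if i == z' then Some Qc else
  if i == x then Some Qa else None.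

Lemma Q5_test_idle z z' x p : z \notin p -> z' \notin p ->
  eval (Q5_test z z' x) p = (if x \in p then Some Qa else None) :> adjoin1 Q5.
Proof.
elim: p => [|i p IHp]; first by rewrite eval_nil.
rewrite !in_cons => /norP[zi zp] /norP[z'i z'p]; rewrite eval_cons IHp // /Q5_test.
rewrite eq_sym (negPf zi) eq_sym (negPf z'i) (eq_sym i).
by case: eqP => _ /=; case: (x \in p).
Qed.

Lemma simple_notin z p q : simple (p ++ z :: q) z -> z \notin p /\ z \notin q.
Proof.
rewrite /simple count_cat /= eqxx add1n addnS eqSS addn_eq0.
by move=> /andP[/eqP/count_memPn zp /eqP/count_memPn].
Qed.

Lemma Q5_test_between z z' x p B q (w := p ++ z :: B ++ z' :: q) :
  simple w z -> simple w z' ->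
  eval (Q5_test z z' x) w = Some (if x \in B then Q0 else Qd) :> adjoin1 Q5.
Proof.
move=> /simple_notin[zp]; rewrite mem_cat in_cons => /norP[zB /norP[zz' zq]].
rewrite /w -cat_cons catA => /simple_notin[]; rewrite mem_cat in_cons.
move=> /norP[z'p /norP[_ z'B]] z'q; rewrite -catA cat_cons !(eval_cat, eval_cons).
rewrite !Q5_test_idle // /Q5_test !eqxx eq_sym (negPf zz').
by case: (x \in p); case: (x \in B); case: (x \in q).
Qed.

Lemma Q5_test_swapped z z' x p B q (w := p ++ z' :: B ++ z :: q) :
  simple w z -> simple w z' ->
  eval (Q5_test z z' x) w = Some Q0 :> adjoin1 Q5.
Proof.
rewrite /w => + /simple_notin[z'p]; rewrite mem_cat in_cons => + /norP[z'B /norP[z'z z'q]].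
rewrite -cat_cons catA => /simple_notin[]; rewrite mem_cat in_cons.
move=> /norP[zp /norP[_ zB]] zq; rewrite -catA cat_cons !(eval_cat, eval_cons).
rewrite !Q5_test_idle // /Q5_test !eqxx (negPf z'z).
by case: (x \in p); case: (x \in B); case: (x \in q).
Qed.

Lemma subseq2_split (T : eqType) (a b : T) w : subseq [:: a; b] w ->
  exists p q r, w = p ++ a :: q ++ b :: r.
Proof.
elim: w => //= c w IH; case: eqP => [<-|_].
  by rewrite sub1seq => bw; case/splitPr: bw => q r; exists [::], q, r.
by move=> /IH [p [q [r ->]]]; exists (c :: p), q, r.
Qed.

Lemma split_subseq2 (T : eqType) (a b : T) p q r :
  subseq [:: a; b] (p ++ a :: q ++ b :: r).
Proof.
rewrite -[[:: a; b]]cat0s cat_subseq ?sub0seq //= eqxx sub1seq mem_cat mem_head.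
by rewrite orbT.
Qed.

Lemma subseq2_total (T : eqType) (a b : T) w : a \in w -> b \in w -> a != b ->
  subseq [:: a; b] w || subseq [:: b; a] w.
Proof.
case/splitPr => p q; rewrite mem_cat in_cons eq_sym => /or3P[bp|/eqP->|bq].
- by case/splitPr: bp => p1 p2; rewrite -catA cat_cons split_subseq2 orbT.
- by rewrite eqxx.
- by case/splitPr: bq => q1 q2; rewrite split_subseq2.
Qed.

Lemma eq_subseq2 (T : eqType) (s t : seq T) : uniq s -> uniq t -> s =i t ->
  (forall a b, subseq [:: a; b] s -> subseq [:: a; b] t) -> s = t.
Proof.
elim: s t => [|a s IHs] t us ut st sub.
  by case: t st {ut sub} => // b t /(_ b); rewrite mem_head.
have aN : a \notin s by case/andP: us.
have: a \in t by rewrite -st mem_head.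
move=> at_; case/splitPr: at_ ut st sub => [[|b p] q] ut st sub.
  congr (_ :: _); have aq : a \notin q by case/andP: ut.
  apply: IHs => [||c|c d cd]; first by case/andP: us.
  - by case/andP: ut.
  - by have := st c; rewrite !in_cons; case: eqP => // -> _; rewrite (negPf aN) (negPf aq).
  - have := sub c d (subseq_trans cd (subseq_cons _ _)) => /=; case: eqP => // ca _.
    by move: aN; rewrite -ca (mem_subseq cd) ?mem_head.
have bs : b \in s.
  have := st b; rewrite mem_cat mem_head /= in_cons => /orP[/eqP ba|//].
  by move: ut; rewrite -ba /= mem_cat mem_head orbT.
have := sub a b; rewrite /= eqxx sub1seq bs => /(_ isT).
case: eqP => [ab|_ abs]; first by move: ut; rewrite ab /= mem_cat mem_head orbT.
move: ut => /= /andP[/negP[]].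
by rewrite (mem_subseq abs) // !inE eqxx orbT.
Qed.

Lemma simple_mem w z : simple w z -> z \in w.
Proof. by rewrite /simple -has_pred1 has_count => /eqP->. Qed.

Lemma uniq_filter_simple w : uniq (filter (simple w) w).
Proof.
apply: count_mem_uniq => z; rewrite count_filter mem_filter.
case: (boolP (simple w z)) => [wz|nwz] /=.
  rewrite simple_mem //= -(eqP wz); apply: eq_count => i /=.
  by case: eqP => // ->.
apply/eqP; rewrite eqn0Ngt -has_count; apply/hasPn => i _ /=.
by case: eqP nwz => // ->.
Qed.

Lemma Q1_seps u v : eqM Q1 u v -> filter (simple u) u = filter (simple v) v.
Proof.
move=> uv; have suv := Q1_simple uv.
apply: eq_subseq2 => [||z|z z' zz']; try exact: uniq_filter_simple.
  rewrite !mem_filter suv; case: (boolP (simple v z)) => //= vz.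
  by rewrite !simple_mem // suv.
have [zu z'u] : simple u z /\ simple u z'.
  have := mem_subseq zz'; move=> sub; have := sub z; have := sub z'.
  by rewrite !mem_filter !inE !eqxx orbT => /(_ isT)/andP[-> _] /(_ isT)/andP[-> _].
have [p [B [q uE]]] := subseq2_split (subseq_trans zz' (filter_subseq _ _)).
have neq : z != z' by have := subseq_uniq zz' (uniq_filter_simple u); rewrite /= inE andbT.
have [zv z'v] : simple v z /\ simple v z' by rewrite -!suv.
have := subseq2_total _ _ neq; move=> /(_ (filter (simple v) v)).
rewrite !mem_filter zv z'v !simple_mem // => /(_ isT isT) /orP[//|z'z].
have [p' [B' [q' vE]]] := subseq2_split (subseq_trans z'z (filter_subseq _ _)).
(* A probe letter absent from [B] makes the value on the left bc, against 0 on the right. *)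
have [t tu] := fresh B.
move/sat_Q1: uv => /(_ (Q5_test z z' t)) /=.
rewrite uE vE Q5_test_between -?uE // Q5_test_swapped -?vE //.
by rewrite (negPf tu).
Qed.

(** The block is enclosed by two simple letters, its own separator and the preceding one, or [z0]
    for the first block; the probe is applied between them. *)
Lemma Q1_blocks z ds1 d ds2 z0 (w1 := z0 :: join_blocks (blocks_l (ds1 ++ d :: ds2)))
    (w2 := z0 :: join_blocks (blocks_r (ds1 ++ d :: ds2))) :
  {in z0 :: unzip2 (ds1 ++ d :: ds2), simple w1 =1 xpredT} ->
  {in z0 :: unzip2 (ds1 ++ d :: ds2), simple w2 =1 xpredT} ->
  eqM Q1 w1 w2 -> (z \in d.1.1) = (z \in d.1.2).
Proof.
move=> s1 s2 /sat_Q1 w12.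
have lastsep bs : exists p, z0 :: join_blocks bs = rcons p (last z0 (unzip2 bs)).
  case/lastP: bs => [|bs [B t]]; first by exists [::].
  exists (z0 :: join_blocks bs ++ B).
  by rewrite /unzip2 map_rcons last_rcons -cats1 join_blocks_cat join_blocks_cons -!cats1 /= -catA.
pose y := last z0 (unzip2 ds1).
have [p1 p1E] := lastsep (blocks_l ds1); have [p2 p2E] := lastsep (blocks_r ds1).
rewrite unzip2_blocks_l -/y in p1E; rewrite unzip2_blocks_r -/y in p2E.
have w1E : w1 = p1 ++ y :: d.1.1 ++ d.2 :: join_blocks (blocks_l ds2).
  by rewrite /w1 /blocks_l map_cat join_blocks_cat -cat_cons p1E cat_rcons join_blocks_cons.
have w2E : w2 = p2 ++ y :: d.1.2 ++ d.2 :: join_blocks (blocks_r ds2).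
  by rewrite /w2 /blocks_r map_cat join_blocks_cat -cat_cons p2E cat_rcons join_blocks_cons.
have yds : y \in z0 :: unzip2 (ds1 ++ d :: ds2).
  have := mem_last z0 (unzip2 ds1); rewrite -/y /unzip2 map_cat !in_cons mem_cat.
  by case/orP => ->; rewrite ?orbT.
have dds : d.2 \in z0 :: unzip2 (ds1 ++ d :: ds2).
  by rewrite in_cons /unzip2 map_cat mem_cat /= mem_head !orbT.
have := w12 (Q5_test y d.2 z); rewrite /= w1E w2E !Q5_test_between -?w1E -?w2E ?s1 ?s2 //.
by case: (z \in d.1.1); case: (z \in d.1.2).
Qed.

Lemma normal_form u v : eqM Q1 u v ->
  exists2 ds, reduced ds & forall M, varE1 M ->
    (eqM M u v <-> eqM M (jn (blocks_l ds)) (jn (blocks_r ds))).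
Proof.
(* Fresh letters at both ends put every block between two simple letters. *)
move=> uv; have [z0 z0uv] := fresh (u ++ v).
have [z1 z1uv] := fresh (z0 :: u ++ v).
move: z0uv z1uv; rewrite in_cons !mem_cat => /norP[z0u z0v] /norP[z10 /norP[z1u z1v]].
(* [z0] opens the first block for the test by Q^1. The normal form itself is that of [rcons u z1]
   and [rcons v z1], and deleting [z1] recovers the original identity. *)
pose ext w : word := z0 :: rcons w z1.
have count0 w : z0 \notin w -> count_mem z0 (ext w) = 1.
  by move=> /count_memPn w0; rewrite /ext /= eqxx -cats1 count_cat w0 /= (negPf z10).
have count1 w : z1 \notin w -> count_mem z1 (ext w) = 1.
  by move=> /count_memPn w0; rewrite /ext /= eq_sym (negPf z10) -cats1 count_cat w0 /= eqxx.
have UV : eqM Q1 (ext u) (ext v).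
  by rewrite /ext -!cats1; apply: (@eqM_catl _ [:: z0]); apply: eqM_catr.
pose S := simple (ext u).
have SV : simple (ext v) =1 S by move=> z; rewrite /S (Q1_simple UV).
have S0 : S z0 by rewrite /S /simple count0.
have S1 : S z1 by rewrite /S /simple count1.
have [bs bsE wbs] := split_blocks u S1; have [cs csE wcs] := split_blocks v S1.
have bcs : unzip2 bs = unzip2 cs.
  rewrite -!(@filter_join_blocks S) // -bsE -csE.
  have := Q1_seps UV; rewrite (eq_filter SV) /ext /= -/S S0.
  by case.
have [ds [bsds csds]] := pair_blocks bcs; subst bs cs.
have nf w es : z0 \notin w -> rcons w z1 = join_blocks es -> all (well_split S) es ->
    simple (ext w) =1 S -> eqM E1 (rcons w z1) (jn es).
  move=> z0w wE wes Sw; rewrite -(dblS_join_blocks wes) -wE.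
  apply: E1_dblS => c cw Sc; have cz0 : (z0 == c) = false by apply: contraNF Sc => /eqP<-.
  have : 0 < count_mem c (rcons w z1) by rewrite -has_count has_pred1.
  move: Sc; rewrite -Sw /simple /ext /= cz0 add0n.
  by case: (count_mem c _) => [|[|]].
have lE := eqM_trans (nf _ _ z0u bsE wbs (fun=> erefl)) (E1_ini_blocks_l ds).
have rE := eqM_trans (nf _ _ z0v csE wcs SV) (E1_ini_blocks_r ds).
exists [seq ini_blocks d | d <- ds]; last first.
  move=> M ME; apply: iff_trans (_ : eqM M (rcons u z1) (rcons v z1) <-> _).
    split=> [uvM|]; first by rewrite -!cats1; apply: eqM_catr.
    move/(eqM_filter (predC1 z1)); rewrite !filter_rcons /= eqxx.
    have nz1 w : z1 \notin w -> [seq i <- w | i != z1] = w.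
      by move=> z1w; apply/all_filterP/allP => i; apply: contraL => /eqP->.
    by rewrite !nz1.
  have lM := varE1_eqM ME lE; have rM := varE1_eqM ME rE.
  split=> H; first exact: eqM_trans (eqM_sym lM) (eqM_trans H rM).
  exact: eqM_trans lM (eqM_trans H (eqM_sym rM)).
have seps : unzip2 ds = filter S (rcons u z1).
  by rewrite bsE filter_join_blocks // unzip2_blocks_l.
have S_seps : {in z0 :: unzip2 ds, forall z, S z}.
  by move=> z; rewrite in_cons seps mem_filter => /orP[/eqP->//|/andP[]].
have E2 : unzip2 [seq ini_blocks d | d <- ds] = unzip2 ds.
  by rewrite /unzip2 -map_comp.
split.
- rewrite E2 seps; have := uniq_filter_simple (ext u).
  by rewrite -/S /ext /= S0 => /andP[].
- move=> _ _ /mapP[d dds ->] /mapP[e eds ->] /=; rewrite mem_ini.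
  have /= := allP wbs (e.1.1, e.2) (map_f _ eds).
  rewrite /well_split /= => /andP[_ /allP nS]; apply/negP => /nS /=.
  by rewrite S_seps // in_cons (map_f snd dds) orbT.
- by move=> _ /mapP[d _ ->]; apply: ini_uniq.
- move=> _ /mapP[d dds ->]; apply: uniq_perm; rewrite ?ini_uniq // => z /=.
  rewrite !mem_ini; case/splitPr: dds => ds1 ds2 in bsE csE S_seps *.
  have w1 : {in z0 :: unzip2 (ds1 ++ d :: ds2), simple (z0 :: join_blocks (blocks_l (ds1 ++ d :: ds2))) =1 xpredT}.
    by rewrite -bsE => y /S_seps; rewrite /S => ->.
  have w2 : {in z0 :: unzip2 (ds1 ++ d :: ds2), simple (z0 :: join_blocks (blocks_r (ds1 ++ d :: ds2))) =1 xpredT}.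
    by rewrite -csE => y /S_seps; rewrite -SV => ->.
  have := @Q1_blocks z ds1 d ds2 z0 w1 w2; rewrite /= -bsE -csE; exact.
Qed.

(** * Strictness *)

Section SyntacticMonoid.

Local Open Scope quotient_scope.

Variable W : word -> Prop.

Definition syntactic_rel : rel word :=
  fun u v => `[< forall a b, W (a ++ u ++ b) <-> W (a ++ v ++ b) >].

Lemma syntactic_refl : reflexive syntactic_rel.
Proof. by move=> u; apply/asboolP. Qed.

Lemma syntactic_sym : symmetric syntactic_rel.
Proof. by move=> u v; apply/asboolP/asboolP => uv a b; rewrite uv. Qed.

Lemma syntactic_trans : transitive syntactic_rel.
Proof.
by move=> v u w /asboolP uv /asboolP vw; apply/asboolP => a b; rewrite uv.
Qed.

Canonical syntactic_equiv :=
  EquivRel syntactic_rel syntactic_refl syntactic_sym syntactic_trans.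

Definition syntactic : Type := {eq_quot syntactic_equiv}.

HB.instance Definition _ := Choice.on syntactic.

Definition syn_class (u : word) : syntactic := \pi_({eq_quot syntactic_equiv}) u.

Definition syn_repr (p : syntactic) : word := repr (p : {eq_quot syntactic_equiv}).

Lemma syn_reprK : cancel syn_repr syn_class.
Proof. by move=> p; rewrite /syn_class /syn_repr reprK. Qed.

Lemma syn_classP u v : syn_class u = syn_class v <->
  forall a b, W (a ++ u ++ b) <-> W (a ++ v ++ b).
Proof.
split; first by move/eqmodP/asboolP.
by move=> uv; apply/eqmodP/asboolP.
Qed.

Definition syn_mul (p q : syntactic) : syntactic :=
  syn_class (syn_repr p ++ syn_repr q).

Lemma syn_mulE u v : syn_mul (syn_class u) (syn_class v) = syn_class (u ++ v).
Proof.
have reprE w := (syn_classP _ _).1 (syn_reprK (syn_class w)).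
apply/syn_classP => a b; rewrite -!catA; apply: iff_trans (reprE u a _) _.
by have := reprE v (a ++ u) b; rewrite -!catA.
Qed.

Lemma syn_mulA : associative syn_mul.
Proof.
move=> p q r; rewrite -(syn_reprK p) -(syn_reprK q) -(syn_reprK r).
by rewrite !syn_mulE catA.
Qed.

Lemma syn_mul1g : left_id (syn_class [::]) syn_mul.
Proof. by move=> p; rewrite -(syn_reprK p) syn_mulE. Qed.

Lemma syn_mulg1 : right_id (syn_class [::]) syn_mul.
Proof. by move=> p; rewrite -(syn_reprK p) syn_mulE cats0. Qed.

HB.instance Definition _ := isMonoid.Build syntactic syn_mulA syn_mul1g syn_mulg1.

Lemma eval_syn (f : nat -> word) w :
  eval (fun i => syn_class (f i)) w = syn_class (subst f w).
Proof.
elim: w => [|i w IHw]; first by rewrite eval_nil.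
by rewrite eval_cons IHw [LHS]syn_mulE.
Qed.

Lemma syn_sat s : satisfies syntactic s <->
  forall (f : nat -> word) a b, W (a ++ subst f s.1 ++ b) <-> W (a ++ subst f s.2 ++ b).
Proof.
split=> [sat f|sat g]; first by apply/syn_classP; rewrite -!eval_syn.
have -> : g = fun i => syn_class (syn_repr (g i)).
  by apply: functional_extensionality_dep => i; rewrite syn_reprK.
by rewrite !eval_syn; apply/syn_classP.
Qed.

End SyntacticMonoid.

(** An identity of E^1, applied anywhere inside a word, does not change its E^1-class, so it cannot
    lead into or out of the chosen class. *)
Lemma varE1_syntactic w0 : varE1 (syntactic (fun w => eqM E1 w w0)).
Proof.
apply/variety_gen_sat => s sE; apply/syn_sat => f a b.
have H : eqM E1 (a ++ subst f s.1 ++ b) (a ++ subst f s.2 ++ b).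
  by apply/eqM_catl/eqM_catr/eqM_subst; case: s sE.
by split; apply: eqM_trans => //; apply: eqM_sym.
Qed.

Lemma E1_sigma_inf : ~ satisfies E1 sigma_inf.
Proof.
(* With x = b, y = c and h = a, the left side is ab = 0 and the right side is ac, which is not 0. *)
move=> /sat_E1 /(_ (fun i => nth None [:: Some Eb; Some Ec; Some Ea] i)).
by rewrite !eval_cons eval_nil.
Qed.

Lemma varE1_E1 : varE1 E1.
Proof. exact/variety_gen_sat. Qed.

Lemma E1_sigma n : 0 < n -> ~ satisfies E1 (sigma n).
Proof. by move=> n0 /(sigma_sigma_inf varE1_E1 n0); apply: E1_sigma_inf. Qed.

Lemma eval_eq1 (phi : nat -> adjoin1 E5) w : eval phi w = None -> {in w, forall i, phi i = None}.
Proof.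
elim: w => // i w IHw; rewrite eval_cons => H.
have [i1 w1] : phi i = None /\ eval phi w = None.
  by move: H; case: (phi i) => [[]|]; case: (eval phi w) => [[]|].
by move=> j; rewrite in_cons => /orP[/eqP->//|]; apply: IHw.
Qed.

(** Multiplying a on the right by anything other than 1 never gives a, so the last letter with a
    nontrivial value must have value a. *)
Lemma eval_eqa (phi : nat -> adjoin1 E5) w : eval phi w = Some Ea ->
  exists p z q, [/\ w = p ++ z :: q, phi z = Some Ea & {in q, forall i, phi i = None}].
Proof.
elim: w => [|i w IHw]; first by rewrite eval_nil.
rewrite eval_cons => H.
have [[i1 w1]|/IHw [p [z [q [-> za q1]]]]] :
    phi i = Some Ea /\ eval phi w = None \/ eval phi w = Some Ea.
  by move: H; case: (phi i) => [[]|]; case: (eval phi w) => [[]|] //; auto.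
  by exists [::], i, w; split=> //; apply: eval_eq1.
by exists (i :: p), z, q.
Qed.

Lemma eval_eqbc (phi : nat -> adjoin1 E5) w e : e = Eb \/ e = Ec ->
  eval phi w = Some e -> exists2 i, i \in w & phi i = Some e.
Proof.
move=> ebc; elim: w => [|i w IHw]; first by rewrite eval_nil.
rewrite eval_cons => H.
have [ie|/IHw [j jw je]] : phi i = Some e \/ eval phi w = Some e.
  by case: ebc H => ->; case: (phi i) => [[]|]; case: (eval phi w) => [[]|] //; auto.
  by exists i; rewrite ?mem_head.
by exists j; rewrite // in_cons jw orbT.
Qed.

(** Idempotents commute unless they are b and c. Exchanging those changes only which of the two
    comes first, and every left factor other than 1 and a hides this. *)
Lemma E5_swap (A X Y D : adjoin1 E5) :
  (A * ((X * X) * ((Y * Y) * D)))%g <> (A * ((Y * Y) * ((X * X) * D)))%g ->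
  (A = None \/ A = Some Ea) /\ (X = Some Eb /\ Y = Some Ec \/ X = Some Ec /\ Y = Some Eb).
Proof.
by case: A => [[]|]; case: X => [[]|]; case: Y => [[]|]; case: D => [[]|] => //= H;
  split; auto; case: H.
Qed.

Fixpoint altword (c d : nat) (n : nat) : word :=
  if n is n'.+1 then c :: altword d c n' else [::].

Lemma subseq_altword_subst f c d i n : c \in f 0 -> d \in f 1 ->
  subseq (altword (if odd i then c else d) (if odd i then d else c) n)
         (subst f (sigma_run i n)).
Proof.
move=> cf df; elim: n i => // n IHn i.
rewrite [sigma_run _ _]/= subst_cat subst_cons -[altword _ _ _]cat1s.
apply: cat_subseq.
  by rewrite /e_word sub1seq; case: (odd i); rewrite !subst_cons mem_cat ?cf ?df.
have -> : (if odd i then d else c) = (if odd i.+1 then c else d) by rewrite /=; case: odd.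
have -> : (if odd i then c else d) = (if odd i.+1 then d else c) by rewrite /=; case: odd.
apply: subseq_trans (IHn _) _; exact: suffix_subseq.
Qed.

(** A word that misses one of the two letters can contribute at most one letter to an alternating
    subsequence. *)
Lemma subseq_altword_cat c d n p w : (c \notin w) || (d \notin w) ->
  subseq (altword c d n.+1) (p ++ w) -> subseq (altword c d n) p.
Proof.
elim: p c d n => [|a p IHp] c d n cdw.
  case: n => // n /mem_subseq sub; move: cdw.
  by rewrite !sub //= !in_cons eqxx ?orbT.
rewrite [altword _ _ _.+1]/= /=; case: eqP => [<-|_].
  case: n => //= n; rewrite eqxx => H.
  by apply: (IHp d c n); rewrite // orbC.
by move=> H; apply: subseq_trans (IHp _ _ _ cdw H) (subseq_cons _ _).
Qed.

Lemma sigma_run_cat i n m : sigma_run i (n + m) = sigma_run i n ++ sigma_run (i + n) m.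
Proof.
elim: n i => [|n IHn] i; first by rewrite addn0.
by rewrite /= IHn addSnnS -catA.
Qed.

Lemma count_sigma_run c i n : 1 < c -> count_mem c (sigma_run i n) = (i < c <= i + n).
Proof.
move=> c1; elim: n i => [|n IHn] i /=; first by rewrite addn0; case: leqP.
rewrite count_cat /= IHn.
have -> : count_mem c (e_word i) = 0.
  by apply/count_memPn; rewrite /e_word; case: (odd i); rewrite !inE; case: c c1 {IHn} => [|[]].
rewrite add0n addSnnS /var_h; case: (ltngtP i.+1 c) => //= <-.
by rewrite addnS ltnS leq_addr.
Qed.

Lemma L21_mem u v : eqM L21 u v -> u =i v.
Proof.
move=> /sat_L21 uv i; pose f j : adjoin1 L2 := if j == i then Some La else None.
have ev w : eval f w = if i \in w then Some La else None.
  elim: w => [|j w IHw]; first by rewrite eval_nil.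
  by rewrite eval_cons IHw in_cons /f eq_sym; case: eqP => _ /=; case: (i \in w).
by have := uv f; rewrite /= !ev; case: (i \in u); case: (i \in v).
Qed.

(** * Words equal in E^1 to the left side of sigma_n *)

Section SigmaClass.

Variable n : nat.
Hypothesis n0 : 0 < n.
Let w0 := (sigma n).1.
Variable w : word.
Hypothesis ww0 : eqM E1 w w0.

Let wQ : eqM Q1 w w0 := E1_Q1 ww0.
Let wL : eqM L21 w w0 := E1_L21 ww0.

Lemma w0E : w0 = sigma_run 1 n ++ [:: 0; 0; 1; 1].
Proof. by rewrite /w0 /= sigma_prefixE. Qed.

Lemma simple_sigma c : simple w c = (1 < c <= n.+1).
Proof.
rewrite (Q1_simple wQ) /simple w0E count_cat.
case: (ltnP 1 c) => c1.
  rewrite count_sigma_run // add1n c1 /=.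
  by case: c c1 => [|[|c]] //= _; rewrite !addn0; case: leqP.
by case: c c1 => [|[|]] //= _; rewrite !addn2.
Qed.

Lemma mem_sigma c : c \in w -> c <= n.+1.
Proof.
rewrite (L21_mem wL) w0E mem_cat => /orP[|].
  case: (ltnP 1 c) => c1; last by rewrite (leq_trans c1).
  by rewrite -has_pred1 has_count count_sigma_run //; case: andP => // -[].
by rewrite !inE => /or4P[] /eqP->.
Qed.

Lemma sigma_split i : 0 < i < n -> exists p q,
  w0 = p ++ var_h i :: e_word i.+1 ++ var_h i.+1 :: q.
Proof.
move=> /andP[i0 lt_in]; rewrite w0E.
have -> : n = i.-1 + (n - i.+1).+2 by rewrite -{1}(subnKC lt_in) !addnS -!addSn prednK.
rewrite sigma_run_cat add1n prednK //=.
exists (sigma_run 1 i.-1 ++ e_word i), (sigma_run i.+2 (n - i.+1) ++ [:: 0; 0; 1; 1]).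
by rewrite -!catA /= -!catA.
Qed.

Lemma simple_h i : 0 < i <= n -> simple w (var_h i).
Proof. by rewrite simple_sigma !ltnS. Qed.

Lemma simple_h0 i : 0 < i <= n -> simple w0 (var_h i).
Proof. by rewrite -(Q1_simple wQ); apply: simple_h. Qed.

Lemma sigma_between i p B q : 0 < i < n ->
  w = p ++ var_h i :: B ++ var_h i.+1 :: q -> B =i e_word i.+1.
Proof.
move=> iin wE x; have [i0 lt_in] := andP iin; have [p0 [q0 w0E']] := sigma_split iin.
have le1 : 0 < i <= n by rewrite i0 ltnW.
have le2 : 0 < i.+1 <= n by [].
have := simple_h0 le2; have := simple_h0 le1; have := simple_h le2; have := simple_h le1.
have /sat_Q1/(_ (Q5_test (var_h i) (var_h i.+1) x)) /= := wQ.
rewrite wE w0E' => E s1 s2 s3 s4; move: E; rewrite !Q5_test_between //.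
by case: (x \in B); case: (x \in e_word _).
Qed.

Lemma sigma_order i p q : 0 < i < n -> w = p ++ var_h i.+1 :: q -> var_h i \in p.
Proof.
move=> iin wE; have [i0 lt_in] := andP iin; have [p0 [q0 w0E']] := sigma_split iin.
have le1 : 0 < i <= n by rewrite i0 ltnW.
have le2 : 0 < i.+1 <= n by [].
have := simple_mem (simple_h le1); rewrite wE mem_cat in_cons.
case/or3P => [//|/eqP[] /eqP|hq]; first by rewrite (ltn_eqF (ltnSn i)).
case/splitPr: hq wE => B q' wE.
have := simple_h0 le2; have := simple_h0 le1; have := simple_h le2; have := simple_h le1.
(* The probe letter has to avoid the block e_(i+1), so that [w0] has value bc rather than 0. *)
have /sat_Q1/(_ (Q5_test (var_h i) (var_h i.+1) (var_h i))) /= := wQ.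
rewrite wE w0E' => E s1 s2 s3 s4; move: E; rewrite Q5_test_swapped // Q5_test_between //.
rewrite /e_word; case: odd; rewrite !inE /var_h //.
by case: i i0 {iin lt_in le1 le2 w0E' wE s1 s2 s3 s4}.
Qed.

(** In [w0] the letter h_1 occurs before the first y, and L_2^1 preserves the order of first
    occurrences. *)
Lemma sigma_before_h1 p q : w = p ++ var_h 1 :: q -> 1 \notin p.
Proof.
move=> wE; pose f i : adjoin1 L2 :=
  if i == 1 then Some La else if i == 2 then Some Lb else None.
have s2 : simple w 2 by rewrite simple_sigma.
have [p2 _] : 2 \notin p /\ 2 \notin q by apply: simple_notin; rewrite -[_ ++ _]wE.
have ev r : 2 \notin r -> eval f r = if 1 \in r then Some La else None.
  elim: r => [|i r IHr]; first by rewrite eval_nil.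
  rewrite !in_cons => /norP[i2 r2]; rewrite eval_cons IHr // /f eq_sym.
  by case: eqP => _ /=; rewrite ?(eq_sym i) ?(negPf i2); case: (1 \in r).
have /sat_L21/(_ f) /= := wL; rewrite -/w0 w0E wE eval_cat eval_cons ev //.
case: n n0 => // m _; rewrite /= !eval_cons.
by case: (1 \in p) => //=; rewrite /f /=; case: (eval _ _) => [?|]; case: (eval _ _).
Qed.

(** There is no y before h_1, and every later block up to h_i contains only one of x and y, so it
    lengthens an alternation by at most one. *)
Lemma sigma_no_altword i p q c d : 0 < i <= n -> w = p ++ var_h i :: q ->
  (c == 0) && (d == 1) || (c == 1) && (d == 0) -> ~~ subseq (altword c d i.+1) p.
Proof.
move=> + + cd; elim: i p q => // -[_ p q _ wE|i IHi p q iin wE].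
  apply/negP => /mem_subseq sub; move: (sigma_before_h1 wE); rewrite sub //.
  by case/orP: cd => /andP[/eqP-> /eqP->].
have lt_in : 0 < i.+1 < n by case/andP: iin.
have := sigma_order lt_in wE => hp; case/splitPr: hp wE => p' B wE.
apply/negP => H; have {H} := subseq_altword_cat _ H; rewrite -catA in wE.
move=> H; have : ~~ subseq (altword c d i.+2) p'.
  by apply: IHi wE => //; case/andP: lt_in => _ /ltnW.
case/negP; apply: H; rewrite !in_cons !negb_or.
have BE := sigma_between lt_in wE; rewrite !BE.
by move: cd; rewrite /e_word; case/orP => /andP[/eqP-> /eqP->]; case: odd.
Qed.

End SigmaClass.

Lemma simple_square c g p q : c \in g -> ~~ simple (p ++ (g ++ g) ++ q) c.
Proof.
rewrite -has_pred1 has_count /simple !count_cat.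
case: (count_mem c g) => // k _; rewrite addSn addnS !addSn !addnS.
by [].
Qed.

Lemma subseq_cat_disjoint (T : eqType) (s p q : seq T) :
  {in s, forall i, i \notin q} -> subseq s (p ++ q) -> subseq s p.
Proof.
move=> sq spq; have := subseq_filter s (p ++ q) (mem s); rewrite spq andbT.
rewrite filter_cat; have -> : filter (mem s) q = [::].
  apply/eqP; rewrite -(negbK (_ == _)) -has_filter; apply/hasPn => i iq.
  by apply: contraL iq => /sq.
rewrite cats0 => E; apply: subseq_trans (filter_subseq (mem s) p).
by rewrite E; apply/allP.
Qed.

Lemma mem_altword c d n : {subset altword c d n <= [:: c; d]}.
Proof.
elim: n c d => // n IHn c d i; rewrite /= in_cons => /orP[/eqP->|/IHn].
  by rewrite mem_head.
by rewrite !inE orbC.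
Qed.

(** A valuation separating the two words gives [P] the value 1 or a, and some letters c of [f 0] and
    d of [f 1] the values b and c of E. These letters are repeated, so they are x and y, and [P]
    contains n + 1 alternations of them. Hence the value of [P] is a, produced by some h_j after
    which [P] contains neither letter. The case j = n contradicts the bound on alternations; for j <
    n no position is left for h_(j+1). *)
Lemma sigma_class_swap n f a b g1 g2 (P := a ++ subst f (sigma_prefix n.+1)) : 0 < n ->
  g1 = f 0 /\ g2 = f 1 \/ g1 = f 1 /\ g2 = f 0 ->
  eqM E1 (P ++ (g1 ++ g1) ++ (g2 ++ g2) ++ b) (sigma n).1 ->
  eqM E1 (P ++ (g1 ++ g1) ++ (g2 ++ g2) ++ b) (P ++ (g2 ++ g2) ++ (g1 ++ g1) ++ b).
Proof.
move=> n0 g12; set w := P ++ _ => ww0.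
apply/sat_E1 => phi /=; apply: contrapT; rewrite /w !(eval_cat phi P).
rewrite !(eval_cat phi (g1 ++ g1)) !(eval_cat phi (g2 ++ g2)) !(eval_cat phi g1) !(eval_cat phi g2).
rewrite !(eval_cat phi (g1 ++ g1)) !(eval_cat phi g1).
move=> /E5_swap [PE gE].
have [e [e' [ee' f0e f1e]]] : exists e e', [/\ e = Eb /\ e' = Ec \/ e = Ec /\ e' = Eb,
    eval phi (f 0) = Some e & eval phi (f 1) = Some e'].
  case: g12 => -[E1 E2]; rewrite E1 E2 in gE;
    case: gE => -[E3 E4]; first [by exists Eb, Ec; split; auto | by exists Ec, Eb; split; auto].
have [ebc e'bc] : (e = Eb \/ e = Ec) /\ (e' = Eb \/ e' = Ec).
  by case: ee' => -[-> ->]; auto.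
have [c cf ce] := eval_eqbc ebc f0e; have [d df de] := eval_eqbc e'bc f1e.
have cd : c != d.
  by apply/eqP => cd; move: ce; rewrite cd de; case: ee' => -[-> ->].
have small i : i \in f 0 ++ f 1 -> i \in w /\ ~~ simple w i.
  have sq1 j : j \in g1 -> j \in w /\ ~~ simple w j.
    by move=> jg; rewrite simple_square // /w !mem_cat jg !orbT.
  have sq2 j : j \in g2 -> j \in w /\ ~~ simple w j.
    by move=> jg; rewrite /w catA simple_square // !mem_cat jg !orbT.
  by rewrite mem_cat; case: g12 => -[<- <-] /orP[]; auto.
have le1 i : i \in w -> ~~ simple w i -> i <= 1.
  move=> /(mem_sigma ww0) ile; rewrite (simple_sigma ww0) ile andbT -leqNgt //.
have [cw cns] : c \in w /\ ~~ simple w c by apply: small; rewrite mem_cat cf.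
have [dw dns] : d \in w /\ ~~ simple w d by apply: small; rewrite mem_cat df orbT.
have cd01 : (c == 0) && (d == 1) || (c == 1) && (d == 0).
  by have := le1 c cw cns; have := le1 d dw dns; case: (c) cd => [|[|]] //; case: (d) => [|[|]].
have altP : subseq (altword c d n.+1) P.
  apply: subseq_trans (subseq_altword_subst 1 n.+1 cf df) _.
  by rewrite -sigma_prefixE suffix_subseq.
have cP : c \in P by rewrite (mem_subseq altP) ?mem_head.
case: PE => [/eval_eq1 /(_ c cP)|/eval_eqa [p [z [q [PE za q1]]]]]; first by rewrite ce.
have zc : z != c by apply/eqP => zc; move: za; rewrite zc ce; case: ebc => ->.
have zd : z != d by apply/eqP => zd; move: za; rewrite zd de; case: e'bc => ->.
have wE : w = p ++ z :: q ++ (g1 ++ g1) ++ (g2 ++ g2) ++ b by rewrite /w PE -catA.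
have zw : z \in w by rewrite wE mem_cat mem_head orbT.
have z1 : 1 < z.
  by rewrite ltnNge; apply/negP; case/orP: cd01 zc zd => /andP[/eqP-> /eqP->]; case: (z) => [|[|]].
have zn := mem_sigma ww0 zw.
pose j := z.-1; have zj : z = var_h j by rewrite /var_h /j prednK // ltnW.
have jn : 0 < j <= n by move: z1 zn; rewrite zj /var_h !ltnS => -> ->.
have qcd i : i \in [:: c; d] -> i \notin q.
  move=> icd; apply/negP => /q1; move: icd; rewrite !inE => /orP[] /eqP->.
    by rewrite ce.
  by rewrite de.
have altp : subseq (altword c d n.+1) p.
  apply: (@subseq_cat_disjoint _ _ _ (z :: q)); last by rewrite -PE.
  move=> i /mem_altword icd; rewrite in_cons negb_or qcd // andbT.
  by move: icd; rewrite !inE => /orP[] /eqP->; rewrite eq_sym.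
have jn' : j < n.
  have /andP[_] := jn; rewrite leq_eqVlt => /orP[/eqP jE|//].
  rewrite zj jE in wE; have := sigma_no_altword n0 ww0 _ wE cd01.
  by rewrite n0 leqnn altp => /(_ isT).
have jn2 : 0 < j < n by rewrite jn' andbT; case/andP: jn.
have sj : simple w (var_h j.+1) by rewrite (simple_sigma ww0) /var_h !ltnS jn'.
have sz : simple w z by rewrite zj (simple_sigma ww0) /var_h !ltnS.
have zNp : z \notin p by have [] := @simple_notin z p (q ++ (g1 ++ g1) ++ (g2 ++ g2) ++ b); rewrite -?wE.
have ecd : (c \in e_word j.+1) && (d \in e_word j.+1) = false.
  by rewrite /e_word; case/orP: cd01 => /andP[/eqP-> /eqP->]; case: odd.
have gsj i : i \in g1 ++ g2 -> i != var_h j.+1.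
  move=> ig; apply: contraTneq sj => <-; apply: (small i _).2.
  by case: g12 ig => -[-> ->]; rewrite !mem_cat // orbC.
(* The possible places of h_(j+1): before h_j contradicts the order of separators; inside [q] leaves
   a block without c and d; inside the squares it would not be simple; inside [b] leaves a block
   with both c and d. But the block must have exactly the letter of e_(j+1). *)
have := simple_mem sj; rewrite wE !mem_cat in_cons.
case/or3P => [hp|/eqP zh|].
- have [p1 [p2 pE]] : exists p1 p2, p = p1 ++ var_h j.+1 :: p2.
    by case/splitPr: hp => p1 p2; exists p1, p2.
  have := wE; rewrite {1}pE -catA => wE'.
  have := sigma_order ww0 jn2 wE'; rewrite -zj => zp1.
  by move: zNp; rewrite pE mem_cat zp1.
- by move: zj; rewrite -zh => /eqP; rewrite /var_h eqSS eq_sym (ltn_eqF (ltnSn j)).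
rewrite !mem_cat; case/orP => [hq|].
  have [B [q' qE]] : exists B q', q = B ++ var_h j.+1 :: q'.
    by case/splitPr: hq => B q'; exists B, q'.
  have := wE; rewrite qE {1}zj -catA => wE'.
  have BE := sigma_between ww0 jn2 wE'; rewrite qE in qcd.
  have Bcd i : i \in [:: c; d] -> i \notin e_word j.+1.
    by move=> /qcd; rewrite mem_cat negb_or BE => /andP[].
  have := Bcd c (mem_head _ _); have := Bcd d; rewrite !inE eqxx orbT => /(_ isT).
  by rewrite /e_word; case/orP: cd01 => /andP[/eqP-> /eqP->]; case: odd.
have g1h : var_h j.+1 \notin g1.
  by apply/negP => h; have := @gsj (var_h j.+1); rewrite mem_cat h eqxx => /(_ isT).
have g2h : var_h j.+1 \notin g2.
  by apply/negP => h; have := @gsj (var_h j.+1); rewrite mem_cat h orbT eqxx => /(_ isT).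
rewrite (negPf g1h) (negPf g2h) /= => hb.
have [b1 [b2 bE]] : exists b1 b2, b = b1 ++ var_h j.+1 :: b2.
  by case/splitPr: hb => b1 b2; exists b1, b2.
have wE2 : w = p ++ var_h j :: (q ++ (g1 ++ g1) ++ (g2 ++ g2) ++ b1) ++ var_h j.+1 :: b2.
  by rewrite wE bE zj -!catA.
have BE := sigma_between ww0 jn2 wE2.
have : (c \in e_word j.+1) && (d \in e_word j.+1).
  rewrite -!BE !mem_cat; case: g12 => -[-> ->]; by rewrite cf df !orbT.
by rewrite ecd.
Qed.

Lemma syntactic_sigma n (M := syntactic (fun w => eqM E1 w (sigma n).1)) : 0 < n ->
  satisfies M (sigma n.+1) /\ ~ satisfies M (sigma n).
Proof.
move=> n0; split=> [|/syn_sat sat]; last first.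
  (* With the identical substitution and empty context, [sigma n] would put its right side into the
     E^1-class of its left side, and so would hold in E^1. *)
  have := sat (fun i => [:: i]) [::] [::]; rewrite /= !cats0.
  have id w : subst (fun i => [:: i]) w = w.
    by elim: w => // i w IHw; rewrite subst_cons IHw.
  by rewrite !id => H; apply: (E1_sigma n0); apply: eqM_sym (H.1 (@eqM_refl _ _)).
apply/syn_sat => f a b.
have sq i j : subst f [:: i; i; j; j] = (f i ++ f i) ++ (f j ++ f j).
  by rewrite !subst_cons cats0 -catA.
have xy : subst f (x2 ++ y2) = (f 0 ++ f 0) ++ (f 1 ++ f 1) := sq 0 1.
have yx : subst f (y2 ++ x2) = (f 1 ++ f 1) ++ (f 0 ++ f 0) := sq 1 0.
rewrite /= !(subst_cat f (sigma_prefix _)) xy yx.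
rewrite -!(catA (subst f _)) -!(catA (f _ ++ f _)) !(catA a).
by split=> W; apply: eqM_trans (eqM_sym (sigma_class_swap n0 _ W)) W; auto.
Qed.

(** * The interval *)

Lemma varE1_L21 : varE1 L21.
Proof. by apply/variety_gen_sat => s; apply: E1_L21. Qed.

Lemma varE1_Q1 : varE1 Q1.
Proof. by apply/variety_gen_sat => s; apply: E1_Q1. Qed.

Lemma sigma1E : sigma 1 = ([:: 0; 0; 2; 0; 0; 1; 1], [:: 0; 0; 2; 1; 1; 0; 0]).
Proof. by rewrite /sigma sigma_prefixE. Qed.

Lemma L21_sigma1 : satisfies L21 (sigma 1).
Proof.
rewrite sigma1E; apply/sat_L21 => f; rewrite /= !eval_cons eval_nil.
by case: (f 0) (f 1) (f 2) => [[]|] [[]|] [[]|].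
Qed.

Lemma Q1_sigma1 : satisfies Q1 (sigma 1).
Proof.
rewrite sigma1E; apply/sat_Q1 => f; rewrite /= !eval_cons eval_nil.
by case: (f 0) (f 1) (f 2) => [[]|] [[]|] [[]|].
Qed.

Lemma sigma1_level M k : varE1 M -> satisfies M (sigma 1) -> satisfies M (level_identity k).
Proof.
by move=> ME; case: k => [n|]; [apply: sigma_leq | apply: sigma_sigma_inf].
Qed.

Lemma identity_level s : satisfies L21 s -> satisfies Q1 s ->
  (forall M, varE1 M -> satisfies M s) \/
  exists k, forall M, varE1 M -> (satisfies M s <-> satisfies M (level_identity k)).
Proof.
case: s => u v L2s /normal_form [ds red nf].
have [all|[k levk]] := reduced_level red ((nf _ varE1_L21).1 L2s).
  by left=> M ME; apply/(nf M ME)/all.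
by right; exists k => M ME; apply: iff_trans (nf M ME) (levk M ME).
Qed.

Local Open Scope mclass_scope.

Lemma subvariety_is_variety M s : is_variety (subvariety (variety_gen M) s).
Proof.
exists (fun t => satisfies M t \/ t = s) => N; split=> [[/variety_gen_sat MN Ns] t|sat].
  by case=> [/MN|->].
by split; [apply/variety_gen_sat => t Mt|]; apply: sat; auto.
Qed.

Lemma variety_gen_is_variety M : is_variety (variety_gen M).
Proof. by exists (satisfies M) => N; apply: variety_gen_sat. Qed.

Lemma variety_gen_min (M : monoidType) V : is_variety V -> V M -> variety_gen M <= V.
Proof. by move=> Vv VM N NM; apply: NM. Qed.

Lemma variety_gen_self M : variety_gen M M.
Proof. by apply/variety_gen_sat. Qed.

Lemma join_le V : is_variety V ->
  (variety_join varL21 varQ1 <= V <-> V L21 /\ V Q1).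
Proof.
move=> Vv; split=> [JV|[VL VQ] N JN]; last first.
  by apply: JN => //; apply: variety_gen_min.
split; apply: JV => W Wv LW QW; [apply: LW|apply: QW]; exact: variety_gen_self.
Qed.

(** Inside E^1 each defining identity of [V] is void or equivalent to a level; the strongest of
    these levels defines [V], and if there is none then [V] is all of E^1. *)
Lemma classification V : is_variety V -> V L21 -> V Q1 -> V <= varE1 ->
  (exists k, V === subvariety varE1 (level_identity k)) \/ V === varE1.
Proof.
move=> [Sigma VE] /VE VL /VE VQ VE1.
pose K k := exists2 s, Sigma s &
  forall M, varE1 M -> (satisfies M s <-> satisfies M (level_identity k)).
have idl s : Sigma s -> (forall M, varE1 M -> satisfies M s) \/ exists2 k, K k &
    forall M, varE1 M -> (satisfies M s <-> satisfies M (level_identity k)).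
  move=> Ss; have [|[k sk]] := identity_level (VL s Ss) (VQ s Ss); first by left.
  by right; exists k => //; exists s.
case: (pselect (exists k, K k)) => [/level_min [k [[s Ss sk] kmin]]|noK].
  left; exists k => M; split=> [VM|[ME Mk]].
    by have ME := VE1 M VM; split=> //; apply/(sk M ME)/(VE M).1.
  apply/VE => t /idl [|[k' Kk' tk']]; first exact.
  by apply/(tk' M ME); apply: kmin Kk' _ ME Mk.
right=> M; split=> [/VE1 //|ME]; apply/VE => t /idl [|[k Kk _]]; first exact.
by case: noK; exists k.
Qed.

Theorem proposition5p6 :
  (forall V : mclass,
     (is_variety V /\ variety_join varL21 varQ1 <= V /\ V <= varE1)
     <->
     ((exists n : nat, (1 <= n)%N /\ V === subvariety varE1 (sigma n))
      \/ V === subvariety varE1 sigma_inf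
      \/ V === varE1))
  /\ (forall n : nat, (1 <= n)%N ->
        subvariety varE1 (sigma n) < subvariety varE1 (sigma n.+1))
  /\ (forall n : nat, (1 <= n)%N ->
        subvariety varE1 (sigma n) < subvariety varE1 sigma_inf)
  /\ subvariety varE1 sigma_inf < varE1
  /\ variety_join varL21 varQ1 === subvariety varE1 (sigma 1).
Proof.
have eq_var U V : is_variety V -> U === V -> is_variety U.
  by move=> [Sigma VE] UV; exists Sigma => M; rewrite UV.
have level_above k : is_variety (subvariety varE1 (level_identity k)) /\
    variety_join varL21 varQ1 <= subvariety varE1 (level_identity k).
  have Vk := @subvariety_is_variety E1 (level_identity k); split=> //.
  apply/join_le => //; split; split; [exact: varE1_L21 | | exact: varE1_Q1 |].
    exact: sigma1_level varE1_L21 L21_sigma1.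
  exact: sigma1_level varE1_Q1 Q1_sigma1.
have step n : (1 <= n)%N -> subvariety varE1 (sigma n) < subvariety varE1 (sigma n.+1).
  move=> n1; split=> [M [ME Mn]|sub]; first by split=> //; apply: sigma_leq Mn.
  have [Mn1 Mn] := syntactic_sigma n1.
  by apply: Mn; apply: (sub _ (conj (varE1_syntactic _) Mn1)).2.
split; [move=> V; split|split; [exact: step|split; [|split]]].
- move=> [Vv [/(join_le Vv) [VL VQ] VE1]].
  have [[[n|] Vk]|VE] := classification Vv VL VQ VE1; last by right; right.
    by left; exists n.+1.
  by right; left.
- have above k : V === subvariety varE1 (level_identity k) ->
      is_variety V /\ variety_join varL21 varQ1 <= V /\ V <= varE1.
    have [Vk Jk] := level_above k => VE.
    split; [exact: eq_var VE|split=> M]; first by move/Jk/VE.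
    by move/VE => [].
  case=> [[[|n] [//_ VE]]|[VE|VE]]; [exact: (above (Some n)) | exact: (above None) |].
  split; first by apply: eq_var VE; apply: variety_gen_is_variety.
  split=> M; last by move/VE.
  by move=> /(level_above None).2 [ME _]; apply/VE.
- move=> n n1; split=> [M [ME Mn]|sub]; first by split=> //; apply: sigma_sigma_inf Mn.
  (* If [sigma_inf] implied [sigma n] inside E^1, then so would [sigma n.+1], against the previous
     strict inclusion. *)
  apply: (step n n1).2 => M [ME Mn]; apply: sub; split=> //.
  by apply: sigma_sigma_inf Mn.
- split=> [M [] //|sub]; apply: E1_sigma_inf.
  by have [] := sub _ varE1_E1.
- move=> M; split; first exact: (level_above (Some 0)).2.
  move=> [ME M1] W Wv LW QW.
  have [Sigma WE] := Wv.
  (* Any identity of a variety containing both generators is void in E^1 or equivalent there to a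
     level, and [sigma 1] implies every level. *)
  apply/WE => s Ss.
  have := identity_level ((WE _).1 (LW _ (@variety_gen_self _)) s Ss)
    ((WE _).1 (QW _ (@variety_gen_self _)) s Ss).
  by case=> [|[k sk]]; [exact|apply/(sk M ME); apply: sigma1_level].
Qed.
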